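(* Let $N$ be the size of the ID space, let $n \geq |V|$ be an upper bound on the number of devices, let $k \geq \log \log N$, and let $\epsilon > 0$ be any constant, where $n$, $k$ and $\epsilon$ are known to all devices. Then there is a deterministic leader election algorithm in the $\mathsf{Sender}\text{-}\mathsf{CD}$ model with time complexity $O(kN^{1/k} + k n^{1+\epsilon})$ and energy complexity $O(k)$ (the implied constants may depend on $\epsilon$).
   Context: Single-hop radio network: a set $V$ of devices, each device $v$ having a distinct identifier $\mathsf{ID}(v) \in [N] = \{1,\dots,N\}$; $N$ is known to all devices. Communication proceeds in synchronous time slots; in each slot each device (based on its ID, the globally known parameters and all feedback received so far) either stays idle, listens, or transmits a message. In the $\mathsf{Sender}\text{-}\mathsf{CD}$ model, transmitters and listeners receive as feedback either silence (if zero or at least two devices transmit) or the message $m$ (if exactly one device transmits, with message $m$); idle devices receive nothing. Leader election: at termination exactly one device identifies itself as leader and all other devices identify themselves as non-leaders. The time complexity is the worst-case number of time slots; the energy complexity is the worst-case maximum over all devices of the number of time slots in which the device listens or transmits. The algorithm must succeed for every set $V \subseteq [N]$ with $1 \le |V| \le n$. *)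

(* Defs.v *)
From HB Require Import structures.
From mathcomp Require Import all_boot all_order all_algebra.
From mathcomp Require Import all_classical all_reals all_analysis.

Set Implicit Arguments.
Unset Strict Implicit.
Unset Printing Implicit Defensive.
Import Order.TTheory GRing.Theory Num.Theory.

(* Finite messages of unbounded length, encoded as natural numbers. *)
Definition message := nat.

(* What a device does in one slot; [Terminate b] means that it stops and
   identifies itself as the leader (b = true) or as a non-leader (b = false). *)
Inductive action : Type :=
  | Idle
  | Listen
  | Transmit of message
  | Terminate of bool.

Inductive feedback : Type :=
  | Nothing (* an idle device hears nothing, not even silence *)
  | Silence
  | Received of message.

(* A deterministic algorithm on the ID space [N], the identifier j + 1 being
   encoded as j : 'I_N. The history has one entry per elapsed slot, so a device
   also knows the current time. *)
Definition algorithm (N : nat) := 'I_N -> seq feedback -> action.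

Section Execution.
Variables (N : nat) (alg : algorithm N) (V : {set 'I_N}).

(* Feedback given in one slot by the Sender-CD channel to transmitters and
   listeners alike, when device v has history h v. *)
Definition channel (h : 'I_N -> seq feedback) : feedback :=
  let sent :=
    pmap (fun v => if alg v (h v) is Transmit m then Some m else None)
         (enum V) in
  if sent is [:: m] then Received m else Silence.

(* The history of a terminated device no longer grows, so that the device
   remains terminated, with the same output. *)
Fixpoint history (t : nat) (v : 'I_N) : seq feedback :=
  if t is t'.+1 then
    let h := history t' in
    match alg v (h v) with
    | Idle => rcons (h v) Nothing
    | Listen | Transmit _ => rcons (h v) (channel h)
    | Terminate _ => h v
    end
  else [::].

Definition output (t : nat) (v : 'I_N) : option bool :=
  if alg v (history t v) is Terminate b then Some b else None.

Definition terminated_after (t : nat) : Prop :=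
  forall v, v \in V -> output t v <> None.

Definition elects_leader : Prop :=
  exists t, exists2 l, l \in V &
    forall v, v \in V -> output t v = Some (v == l).

Definition awake (t : nat) (v : 'I_N) : bool :=
  match alg v (history t v) with
  | Listen | Transmit _ => true
  | Idle | Terminate _ => false
  end.

Definition energy_used (t : nat) (v : 'I_N) : nat :=
  (\sum_(s < t) awake s v)%N.

End Execution.

Definition admissible (N n : nat) (V : {set 'I_N}) : Prop :=
  (1 <= #|V| <= n)%N.

Definition solves_leader_election (N n : nat) (alg : algorithm N) : Prop :=
  forall V : {set 'I_N}, admissible n V -> elects_leader alg V.

Definition time_complexity_le (N n : nat) (alg : algorithm N) (T : nat) : Prop :=
  forall V : {set 'I_N}, admissible n V -> terminated_after alg V T.

Definition energy_complexity_le (N n : nat) (alg : algorithm N) (E : nat) :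
    Prop :=
  forall V : {set 'I_N}, admissible n V ->
  forall v, v \in V -> forall t, (energy_used alg V t v <= E)%N.

(* Since [ln 0 = 0], [log2 (log2 1) = 0]. *)
Definition log2 (R : realType) (x : R) : R := (ln x / ln 2)%R.

(* Main.v *)
(* Given a map h : [A] -> [B], an element of a set S is alone if no other element
   of S has the same image. By a union bound there are d maps such that every S
   of size at most t has, for one of them, at least half of its elements alone:
   d = O(k) maps suffice for t = n and B = O(n N^(1/k)), and 8 maps suffice when
   B / t and A / B are both of the order of (A / t)^(1/2). A device that transmits
   in slot h(id) learns from the channel whether it is alone, and the devices
   that are alone own distinct identifiers in the smaller space [B].

   This turns identifiers in [N] into identifiers in [M], M close to n N^(1/k),
   with O(k) energy. To elect a leader among devices with distinct identifiers in
   [A] when at least A / r of them are present, take t = A / r^(2/3) and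
   B = A / r^(1/3), up to constants. If at most t devices are present, then those
   alone under one of the maps have density at least 1 / r^(2/3) in [B], and we
   recurse on them. If all these recursive calls fail, then nearly t devices are
   left: they never took part in the calls, and have density at least
   1 / (2 r^(2/3)) in [A]. So log r drops by a constant factor at O(1) energy per
   device, and O(log log A) rounds make the density constant.

   For constant density, cut [A] into blocks of size about log A. Every block
   ranks its members by a binary merging tree of depth O(log log A). The blocks
   with more members than the number of levels left are merged along a binary
   tree, and at level i a block is represented by its member of rank i, so that
   every device acts at O(1) levels only. *)
Require Import Defs.
From mathcomp Require Import all_boot zify.
From mathcomp Require boolp.

Set Implicit Arguments.
Unset Strict Implicit.
Unset Printing Implicit Defensive.
Local Open Scope nat_scope.

(** * Programs of fixed length and their execution on the channel *)

Variant op := Sleep | Hear | Send of message.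

Definition sends (a : op) := if a is Send _ then true else false.
Definition active (a : op) := if a is Sleep then false else true.
Definition received (f : feedback) := if f is Received _ then true else false.
Definition payload (f : feedback) := if f is Received m then m else 0.

(** Indexing by the number of slots keeps all devices in lockstep: composed phases start in the same
    slot everywhere, and the running time is read off the type. *)
Fixpoint prog (X : Type) (T : nat) : Type :=
  if T is T'.+1 then (op * (feedback -> prog X T'))%type else X.

Fixpoint pure (X : Type) (T : nat) (x : X) : prog X T :=
  if T is T'.+1 then (Sleep, fun=> pure T' x) else x.

Fixpoint bind (X Y : Type) (T1 T2 : nat) :
    prog X T1 -> (X -> prog Y T2) -> prog Y (T1 + T2) :=
  if T1 is T.+1 then fun p k => (p.1, fun f => bind (p.2 f) k)
  else fun x k => k x.

(* The device uses only slot [i] out of [B]; nothing happens if [B <= i]. *)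
Fixpoint round (B i : nat) (a : op) : prog feedback B :=
  match B with
  | 0 => Nothing
  | B'.+1 => if i is i'.+1 then (Sleep, fun=> round B' i' a)
             else (a, fun f => pure B' f)
  end.

Fixpoint loop (X : Type) (T : nat) (body : nat -> X -> prog X T) (n i : nat)
    (x : X) : prog X (n * T) :=
  if n is n'.+1 then bind (body i x) (loop body n' i.+1) else x.

Section Run.
Variable I : finType.
Implicit Types (V W : {set I}) (v : I).

Definition chan V (a : I -> op) : feedback :=
  let sent := pmap (fun v => if a v is Send m then Some m else None) (enum V) in
  if sent is [:: m] then Received m else Silence.

Definition heard V (a : I -> op) v : feedback :=
  if active (a v) then chan V a else Nothing.

Fixpoint run (X : Type) (T : nat) V : (I -> prog X T) -> I -> X :=
  if T is T'.+1 then fun p =>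
    run V (fun v => (p v).2 (heard V (fun u => (p u).1) v))
  else id.

Fixpoint energy (X : Type) (T : nat) V : (I -> prog X T) -> I -> nat :=
  if T is T'.+1 then fun p v =>
    active (p v).1 + energy V (fun v => (p v).2 (heard V (fun u => (p u).1) v)) v
  else fun _ _ => 0.

Lemma chan_senders V W a :
  [set v in V | sends (a v)] = [set v in W | sends (a v)] -> chan V a = chan W a.
Proof.
have E (U : {set I}) : pmap (fun v => if a v is Send m then Some m else None) (enum U) =
   pmap (fun v => if a v is Send m then Some m else None)
        (enum [set v in U | sends (a v)]).
  have -> : enum [set v in U | sends (a v)] = filter (fun v => sends (a v)) (enum U).
    rewrite /enum_mem -filter_predI; apply: eq_filter => v /=.
    by rewrite !inE andbC.
  elim: (enum U) => //= v s ->.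
  by case E: (a v) => [||m] //=; rewrite E.
by move=> H; rewrite /chan E (E W) H.
Qed.

Lemma eq_chan V a b : {in V, a =1 b} -> chan V a = chan V b.
Proof.
move=> ab; rewrite /chan.
have -> : pmap (fun v => if a v is Send m then Some m else None) (enum V) =
   pmap (fun v => if b v is Send m then Some m else None) (enum V); last by [].
have : {subset enum V <= V} by move=> v; rewrite mem_enum.
elim: (enum V) => //= v s IH sV.
rewrite ab ?sV ?mem_head // IH // => u us; apply: sV.
by rewrite inE us orbT.
Qed.

Lemma chan_silent V a : {in V, forall v, ~~ sends (a v)} -> chan V a = Silence.
Proof.
move=> H; rewrite (@chan_senders V set0) ?/chan ?enum_set0 //.
apply/setP => v; rewrite !inE /=.
by apply/negbTE/negP => /andP[/H/negP].
Qed.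

Lemma chan_single V a v m : v \in V -> a v = Send m ->
  {in V, forall u, sends (a u) -> u = v} -> chan V a = Received m.
Proof.
move=> vV av H; rewrite (@chan_senders V [set v]) ?/chan ?enum_set1 /= ?av //.
apply/setP => u; rewrite !inE /=; apply/andP/andP => [[uV su]|[/eqP-> _]].
  by rewrite su (H u) ?eqxx.
by rewrite av.
Qed.

Lemma chan_collision V a u v : u \in V -> v \in V -> u != v ->
  sends (a u) -> sends (a v) -> chan V a = Silence.
Proof.
move=> uV vV uv su sv.
have E : pmap (fun v => if a v is Send m then Some m else None)
   (enum [set v in V | sends (a v)]) =
   [seq payload (if a v is Send m then Received m else Silence) |
     v <- enum [set v in V | sends (a v)]].
  have : {in enum [set v in V | sends (a v)], forall v, sends (a v)}.
    by move=> w; rewrite mem_enum inE => /andP[].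
  elim: (enum _) => //= w s IH Hw; rewrite IH => [|x xs].
    by move: (Hw w (mem_head _ _)); case: (a w).
  by apply: Hw; rewrite inE xs orbT.
rewrite (@chan_senders V [set v in V | sends (a v)]) /chan; last first.
  by apply/setP => w; rewrite !inE -andbA andbb.
rewrite E; case Es: [seq _ | _ <- _] => [|m [|m' s]] //.
have := congr1 size Es; rewrite size_map -cardE /=.
have /subset_leq_card : [set u; v] \subset [set v in V | sends (a v)].
  by apply/subsetP => w; rewrite !inE => /orP[] /eqP ->; rewrite ?uV ?vV ?su ?sv.
by rewrite cards2 uv => + E1; rewrite E1.
Qed.

Lemma eq_heard V a b : {in V, a =1 b} -> {in V, heard V a =1 heard V b}.
Proof. by move=> ab v vV; rewrite /heard ab // (eq_chan ab). Qed.

Lemma eq_in_run (X : Type) T V (p q : I -> prog X T) :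
  {in V, p =1 q} -> {in V, run V p =1 run V q}.
Proof.
elim: T p q => [|T IH] p q pq; first exact: pq.
apply: (IH (fun v => (p v).2 (heard V (fun u => (p u).1) v))) => v vV.
by rewrite pq // (eq_heard (b := fun u => (q u).1)) // => u uV; rewrite pq.
Qed.

Lemma eq_in_energy (X : Type) T V (p q : I -> prog X T) :
  {in V, p =1 q} -> {in V, energy V p =1 energy V q}.
Proof.
elim: T p q => [|T IH] p q pq v vV; first by [].
congr addn; first by rewrite pq.
apply: (IH (fun v => (p v).2 (heard V (fun u => (p u).1) v))) => // u uV.
by rewrite pq // (eq_heard (b := fun u => (q u).1)) // => w wV; rewrite pq.
Qed.

Lemma run_bind (X Y : Type) T1 T2 V (p : I -> prog X T1)
    (k : I -> X -> prog Y T2) v :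
  run V (fun u => bind (p u) (k u)) v = run V (fun u => k u (run V p u)) v.
Proof.
elim: T1 p => [|T IH] p; first by [].
exact: (IH (fun u => (p u).2 (heard V (fun w => (p w).1) u))).
Qed.

Lemma energy_bind (X Y : Type) T1 T2 V (p : I -> prog X T1)
    (k : I -> X -> prog Y T2) v :
  energy V (fun u => bind (p u) (k u)) v =
  energy V p v + energy V (fun u => k u (run V p u)) v.
Proof.
elim: T1 p => [|T IH] p; first by [].
rewrite -[RHS]addnA; congr addn.
exact: (IH (fun u => (p u).2 (heard V (fun w => (p w).1) u))).
Qed.

Lemma run_waiting (X : Type) T V (p : I -> prog X T) v x :
  p v = pure T x -> run V p v = x /\ energy V p v = 0.
Proof.
elim: T p => //= T IH p pv; rewrite pv /=.
by apply: IH; rewrite pv.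
Qed.

(** Devices outside [W] sleep throughout, hence never transmit, and those of [W] cannot distinguish
    [V] from [W]. This is what lets a phase be analysed on a subset of the devices. *)
Lemma run_sub (X : Type) T V W (p : I -> prog X T) (x : I -> X) :
  W \subset V -> {in V :\: W, forall v, p v = pure T (x v)} ->
  {in W, forall v, run V p v = run W p v /\ energy V p v = energy W p v}.
Proof.
move=> WV; elim: T p => [|T IH] p Hp v vW //=.
have EC : chan V (fun u => (p u).1) = chan W (fun u => (p u).1).
  apply: chan_senders; apply/setP => u; rewrite !inE.
  case uW: (u \in W); first by rewrite (subsetP WV).
  case uV: (u \in V) => //=; rewrite Hp // !inE uW uV //.
have -> : heard V (fun u => (p u).1) = heard W (fun u => (p u).1).
  by apply: boolp.funext => u; rewrite /heard EC.
have [|-> ->] // := IH (fun u => (p u).2 (heard W (fun u => (p u).1) u)) _ v vW.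
by move=> u uVW; rewrite Hp.
Qed.

(** Induction on [B]: either the first slot belongs to [v], which waits afterwards, or the devices
    of that slot wait from then on and [run_sub] discards them. *)
Lemma run_round B V (s : I -> nat) (a : I -> op) v : v \in V -> s v < B ->
  run V (fun u => round B (s u) (a u)) v =
  if active (a v) then chan [set u in V | s u == s v] a else Nothing.
Proof.
elim: B V s => [|B IH] V s //= vV.
set b := heard V _.
case Es: (s v) => [|i] /= iB.
  rewrite (proj1 (@run_waiting _ _ _ _ _ (b v) _)) ?Es //=.
  rewrite /b /heard Es /=; case: ifP => // av.
  set c := fun u => _.
  rewrite (@chan_senders V [set u in V | s u == 0] c); last first.
    by apply/setP => u; rewrite !inE /c -andbA; case: (s u).
  by apply: eq_chan => u; rewrite !inE /c => /andP[_ /eqP ->].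
pose W := [set u in V | s u != 0].
have vW : v \in W by rewrite inE vV Es.
rewrite (proj1 (@run_sub _ _ V W _ (fun u => b u) _ _ v vW)).
- rewrite (@eq_in_run _ _ W _ (fun u => round B (s u).-1 (a u)) _ v vW).
    rewrite IH ?Es //; case: ifP => // _; congr chan.
    by apply/setP => u; rewrite !inE -andbA; case: (s u).
  by move=> u; rewrite inE => /andP[_]; case: (s u).
- by apply/subsetP => u; rewrite inE => /andP[].
- by move=> u; rewrite !inE => /andP[+ uV]; rewrite uV /=; case: (s u).
Qed.

Lemma energy_round B V (s : I -> nat) (a : I -> op) v : v \in V ->
  energy V (fun u => round B (s u) (a u)) v <= active (a v).
Proof.
elim: B V s => [|B IH] V s //= vV.
set b := heard V _.
case Es: (s v) => [|i] /=.
  by rewrite (proj2 (@run_waiting _ _ _ _ _ (b v) _)) ?Es //= addn0.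
pose W := [set u in V | s u != 0].
have vW : v \in W by rewrite inE vV Es.
rewrite (proj2 (@run_sub _ _ V W _ (fun u => b u) _ _ v vW)).
- rewrite (@eq_in_energy _ _ W _ (fun u => round B (s u).-1 (a u)) _ v vW) ?IH //.
  by move=> u; rewrite inE => /andP[_]; case: (s u).
- by apply/subsetP => u; rewrite inE => /andP[].
- by move=> u; rewrite !inE => /andP[+ uV]; rewrite uV /=; case: (s u).
Qed.

(** [c i] prescribes the states of all devices of [V] before iteration [i], and so serves as the
    loop invariant. *)
Lemma run_loop X T V (body : I -> nat -> X -> prog X T) (c : nat -> I -> X) n :
  (forall i, i < n ->
    {in V, run V (fun v => body v i (c i v)) =1 c i.+1}) ->
  {in V, forall v, run V (fun u => loop (body u) n 0 (c 0 u)) v = c n v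
   /\ energy V (fun u => loop (body u) n 0 (c 0 u)) v =
      \sum_(i < n) energy V (fun u => body u i (c i u)) v}.
Proof.
move=> Hc v vV; rewrite -(big_mkord xpredT (fun i => energy V (fun u => body u i (c i u)) v)).
suff: forall j m, m + j = n -> {in V, forall v,
   run V (fun u => loop (body u) j m (c m u)) v = c n v
   /\ energy V (fun u => loop (body u) j m (c m u)) v =
      \sum_(m <= i < n) energy V (fun u => body u i (c i u)) v}.
  by move=> /(_ n 0 erefl v vV).
elim=> [|j IH] m mj u uV; first by rewrite -mj addn0 big_geq.
have mn : m < n by lia.
have H : {in V, (fun u => loop (body u) j m.+1
      (run V (fun w => body w m (c m w)) u)) =1
    (fun u => loop (body u) j m.+1 (c m.+1 u))}.
  by move=> w wV; rewrite Hc.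
have [|E1 E2] := IH m.+1 _ u uV; first lia.
split; first by rewrite run_bind (eq_in_run H uV).
by rewrite energy_bind (eq_in_energy H uV) E2 [RHS]big_ltn.
Qed.
End Run.

(** * Translation of programs into algorithms *)

Section Compile.
Variable N : nat.
Implicit Types (V : {set 'I_N}) (v : 'I_N).

Definition action_of (a : op) : action :=
  match a with Sleep => Idle | Hear => Listen | Send m => Transmit m end.

Fixpoint replay (T : nat) : prog bool T -> seq feedback -> action :=
  if T is T'.+1 then fun p h =>
    if h is f :: h' then replay (p.2 f) h' else action_of p.1
  else fun b _ => Terminate b.

Definition algorithm_of T (p : 'I_N -> prog bool T) : algorithm N :=
  fun v h => replay (p v) h.

(** [history] grows at its end whereas [replay] consumes it from the front; splitting off the first
    slot reconciles the two recursions. *)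
Lemma history_shift V T (p : 'I_N -> prog bool T.+1) t v :
  let f := heard V (fun u => (p u).1) in
  history (algorithm_of p) V t.+1 v =
  f v :: history (algorithm_of (fun u => (p u).2 (f u))) V t v.
Proof.
move=> f; elim: t v => [|t IH] v.
  rewrite /= /algorithm_of /= /f /heard.
  have -> : channel (fun (v : 'I_N) (h : seq feedback) => replay (p v) h) V (fun=> [::])
     = chan V (fun u => (p u).1).
    rewrite /channel /chan /=.
    rewrite (@eq_pmap _ _ (fun v0 : 'I_N =>
     match action_of (p v0).1 with | Transmit m => Some m | _ => None end)
     (fun v0 : 'I_N => match (p v0).1 with | Send m => Some m | _ => None end)) //.
    by move=> u; case: (p u).1.
  by case: (p v).1.
move: IH; set q := fun u => (p u).2 (f u); set h := history _ V t => IH.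
have chE : channel (algorithm_of p) V (history (algorithm_of p) V t.+1) =
    channel (algorithm_of q) V h.
  by rewrite /channel; congr (match _ with [:: m] => _ | _ => _ end);
     apply: eq_pmap => u; rewrite IH.
transitivity (match algorithm_of p v (history (algorithm_of p) V t.+1 v) with
    | Idle => rcons (history (algorithm_of p) V t.+1 v) Nothing
    | Listen | Transmit _ => rcons (history (algorithm_of p) V t.+1 v)
        (channel (algorithm_of p) V (history (algorithm_of p) V t.+1))
    | Terminate _ => history (algorithm_of p) V t.+1 v
    end) => //.
rewrite chE IH; transitivity (f v :: match algorithm_of q v (h v) with
    | Idle => rcons (h v) Nothing
    | Listen | Transmit _ => rcons (h v) (channel (algorithm_of q) V h)
    | Terminate _ => h v
    end) => //.
have -> : algorithm_of p v (f v :: h v) = algorithm_of q v (h v) by [].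
by case: (algorithm_of q v (h v)).
Qed.

Lemma output_algorithm_of V T (p : 'I_N -> prog bool T) v :
  output (algorithm_of p) V T v = Some (run V p v).
Proof.
elim: T p => [|T IH] p //.
by rewrite /output history_shift /= -IH.
Qed.

Lemma energy_algorithm_of V T (p : 'I_N -> prog bool T) t v :
  energy_used (algorithm_of p) V t v <= energy V p v.
Proof.
rewrite /energy_used; elim: T p t => [|T IH] p t.
  by rewrite big1 // => i _; rewrite /awake /algorithm_of /=.
case: t => [|t]; first by rewrite big_ord0.
rewrite big_ord_recl /=; apply: leq_add.
  by rewrite /awake /= /algorithm_of /=; case: (p v).1.
apply: leq_trans (IH _ t); apply: leq_sum => i _.
by rewrite /bump /= add1n /awake history_shift.
Qed.
End Compile.

(** * Election at constant density *)

Section DenseProgram.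
Variables (Q id : nat).

(* A device knows its rank in its block and the size of the block. The devices
   of rank 0 exchange the sizes of two sibling blocks. *)
Definition census_body (h : nat) (s : nat * nat) : prog (nat * nat) (Q + (Q + 0)) :=
  let b := id %/ 2 ^ h in
  let report := if s.1 == 0 then Send s.2 else Sleep in
  bind (round Q b./2 (if odd b then Hear else report)) (fun f1 =>
  bind (round Q b./2 (if odd b then report else Hear)) (fun f2 =>
  pure 0 (if odd b then (s.1 + payload f1, s.2 + payload f1)
          else (s.1, s.2 + payload f2)))).

(* At level [i] only the devices of rank [i] of a block represent it; those of
   rank [i + 1] take over if their block has not been beaten by a block on its
   left. *)
Definition token_body (g rank i : nat) (rep : bool) : prog bool (Q + (Q + 0)) :=
  let b := g %/ 2 ^ i in
  bind (round Q b (if rep then Send g else if rank == i.+1 then Hear else Sleep))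
    (fun f1 =>
  bind (round Q (if rep then b else b.-1)
         (if rep then Send g else if (rank == i.+1) && odd b then Hear else Sleep))
    (fun f2 =>
  pure 0 [&& rank == i.+1, received f1, payload f1 == g &
             ~~ (odd b && received f2)])).
End DenseProgram.

(** The summands [Q + (Q + 0)] have the shape that [bind] produces, so that the programs typecheck
    by conversion. *)
Definition dense_time (lam H : nat) : nat :=
  let Q := 2 ^ (lam + H) in lam * (Q + (Q + 0)) + H * (Q + (Q + 0)).

(** Each identifier starts as its own block, hence the state [(0, 1)]. A block enters the token
    phase only with more than [H] members, enough for one representative at each level from 0 to
    [H]. *)
Definition dense_prog (lam H id : nat) : prog bool (dense_time lam H) :=
  let Q := 2 ^ (lam + H) in
  bind (loop (census_body Q id) lam 0 (0, 1)) (fun s =>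
    loop (token_body Q (id %/ 2 ^ lam) s.1) H 0 ((s.1 == 0) && (H < s.2))).

(** Ranks are distinct and below [#|W|], so by pigeonhole every value below [#|W|] is attained. *)
Lemma rank_surj (I : finType) (W : {set I}) (id : I -> nat) i :
  {in W &, injective id} -> i < #|W| ->
  exists2 u, u \in W & #|[set w in W | id w < id u]| = i.
Proof.
move=> idI iW; pose r u := #|[set w in W | id w < id u]|.
have r_lt u v : u \in W -> id u < id v -> r u < r v.
  move=> uW uv; apply/proper_card/properP; split.
    by apply/subsetP => w; rewrite !inE => /andP[-> /=]; lia.
  by exists u; rewrite !inE uW ?uv //= ltnn.
have rI : {in W &, injective r}.
  move=> u v uW vW ruv; apply: idI => //.
  by case: (ltngtP (id u) (id v)) => // [/(r_lt u v uW)|/(r_lt v u vW)]; lia.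
have : {subset [seq r u | u <- enum W] <= iota 0 #|W|}.
  move=> j /mapP[u]; rewrite mem_enum => uW ->; rewrite mem_iota /= add0n.
  apply/proper_card/properP; split; first by apply/subsetP => w; rewrite inE => /andP[].
  by exists u; rewrite // !inE uW ltnn.
move/uniq_min_size; rewrite map_inj_in_uniq ?enum_uniq; last first.
  by move=> u v; rewrite !mem_enum; apply: rI.
move=> /(_ isT); rewrite size_iota size_map -cardE => /(_ (leqnn _)) [_ /(_ i)].
rewrite mem_iota /= add0n iW => /mapP[u]; rewrite mem_enum => uW ->.
by exists u.
Qed.

Section Dense.
Variables (I : finType) (V : {set I}) (Q : nat) (id : I -> nat).
Hypothesis idI : {in V &, injective id}.
Hypothesis idQ : forall v, id v < Q.

Definition block h b : {set I} := [set u in V | id u %/ 2 ^ h == b].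
Definition below h v := #|[set u in block h (id v %/ 2 ^ h) | id u < id v]|.

Lemma divn_expS n h : n %/ 2 ^ h.+1 = (n %/ 2 ^ h)./2.
Proof. by rewrite expnSr divnMA divn2. Qed.

Lemma blockS h b : block h.+1 b = block h b.*2 :|: block h b.*2.+1.
Proof.
by apply/setP => u; rewrite !inE divn_expS -andb_orr; congr (_ && _); lia.
Qed.

Lemma card_blockS h b : #|block h.+1 b| = #|block h b.*2| + #|block h b.*2.+1|.
Proof.
rewrite blockS cardsU; have -> : block h b.*2 :&: block h b.*2.+1 = set0.
  by apply/setP => u; rewrite !inE; lia.
by rewrite cards0 subn0.
Qed.

Lemma ltn_block h u v : id u %/ 2 ^ h < id v %/ 2 ^ h -> id u < id v.
Proof. by rewrite !ltnNge; apply: contra => /leq_div2r; apply. Qed.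

Lemma belowS h v : v \in V ->
  below h.+1 v = below h v +
    (if odd (id v %/ 2 ^ h) then #|block h (id v %/ 2 ^ h).-1| else 0).
Proof.
move=> vV; rewrite /below divn_expS; set b := id v %/ 2 ^ h.
rewrite blockS setIdE setIUl -!setIdE cardsU.
have -> : [set u in block h b./2.*2 | id u < id v]
    :&: [set u in block h b./2.*2.+1 | id u < id v] = set0.
  by apply/setP => u; rewrite !inE; lia.
rewrite cards0 subn0; case: ifP => ob.
  have Eb : b./2.*2.+1 = b by lia.
  have Eb' : b./2.*2 = b.-1 by lia.
  rewrite Eb Eb' addnC; congr (_ + _); congr #|pred_of_set _|.
  apply/setP => u; rewrite !inE; case: eqP => [ub|]; rewrite ?andbF // !andbT.
  have lt : id u < id v.
    by apply: (@ltn_block h); rewrite ub -/b; lia.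
  by rewrite lt andbT.
have -> : b./2.*2 = b by lia.
rewrite [X in _ + X](_ : _ = 0) //; apply/eqP; rewrite cards_eq0; apply/eqP/setP => u.
rewrite !inE; apply/negbTE/negP => /andP[/andP[_ /eqP ub]].
by apply/negP; rewrite -leqNgt ltnW // (@ltn_block h) // ub -/b.
Qed.

Lemma below_inj h : {in V &, forall u v, id u %/ 2 ^ h = id v %/ 2 ^ h ->
  below h u = below h v -> u = v}.
Proof.
move=> u v uV vV uv; rewrite /below uv => E; apply: idI => //.
wlog : u v uV vV uv E / id u < id v => [W|lt].
  by case: (ltngtP (id u) (id v)) => // lt; [|apply/esym]; apply: W => //; rewrite uv.
have : [set w in block h (id v %/ 2 ^ h) | id w < id u]
    \proper [set w in block h (id v %/ 2 ^ h) | id w < id v].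
  apply/properP; split.
    by apply/subsetP => w; rewrite !inE => /andP[-> /=]; lia.
  by exists u; rewrite !inE uV uv eqxx ?ltnn //= lt.
by move/proper_card; rewrite E ltnn.
Qed.

Lemma below_surj h v i : i < #|block h (id v %/ 2 ^ h)| ->
  exists2 u, u \in V & id u %/ 2 ^ h = id v %/ 2 ^ h /\ below h u = i.
Proof.
have idB : {in block h (id v %/ 2 ^ h) &, injective id}.
  by move=> x y; rewrite !inE => /andP[xV _] /andP[yV _]; apply: idI.
move=> /(rank_surj idB)[u]; rewrite inE => /andP[uV /eqP ub] E; exists u => //.
by rewrite /below ub.
Qed.

(** The device of rank 0 is the only sender. An empty block leaves the slot silent, and the default
    0 of [payload] is then the right size. *)
Lemma chan_block (W : {set I}) a h b :
  {in W, forall u, sends (a u) ->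
    [/\ u \in V, id u %/ 2 ^ h = b & below h u = 0]} ->
  {in V, forall u, id u %/ 2 ^ h = b -> below h u = 0 ->
    u \in W /\ a u = Send #|block h b|} ->
  payload (chan W a) = #|block h b|.
Proof.
move=> Ws Va; have [b0|[w wb]] := set_0Vmem (block h b).
  rewrite b0 cards0 chan_silent // => u uW; apply/negP => /Ws[//|uV ub _].
  have : u \in block h b by rewrite inE uV ub eqxx.
  by rewrite b0 inE.
have wb' : id w %/ 2 ^ h = b by move: wb; rewrite inE => /andP[_ /eqP].
have [|u uV [ub u0]] := @below_surj h w 0.
  by rewrite wb'; apply/card_gt0P; exists w.
have [uW au] := Va u uV (etrans ub wb') u0.
rewrite (chan_single uW au) // => x xW /(Ws x xW)[xV xb x0].
by apply: (@below_inj h) => //; rewrite ?x0 ?u0 // xb ub.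
Qed.

Lemma idQ_div v m : id v %/ m < Q.
Proof. exact: leq_ltn_trans (leq_div _ _) (idQ v). Qed.

(** Sibling blocks share the slot [b./2]: the even one reports in the first round, the odd one in
    the second. Only the members of the odd block shift their rank, by the size of the even one. *)
Lemma run_census_body h :
  {in V, run V (fun v => census_body Q (id v) h (below h v, #|block h (id v %/ 2 ^ h)|))
    =1 fun v => (below h.+1 v, #|block h.+1 (id v %/ 2 ^ h.+1)|)}.
Proof.
move=> v vV; rewrite /census_body run_bind run_bind /=.
set b := fun u => id u %/ 2 ^ h.
have bQ u : (b u)./2 < Q by apply: leq_ltn_trans (idQ_div u (2 ^ h)); rewrite -/(b u); lia.
rewrite divn_expS card_blockS belowS // -/(b v).
rewrite !run_round //; try exact: bQ.
rewrite /= -!/(b _).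
case ob: (odd (b v)) => /=.
  have -> : (b v)./2.*2.+1 = b v by lia.
  have -> : (b v)./2.*2 = (b v).-1 by lia.
  rewrite (@chan_block _ _ h (b v).-1); first by rewrite [X in (_, X)]addnC.
    move=> u; rewrite inE -/(b u) => /andP[uV /eqP ubv].
    case obu: (odd (b u)) => //=; case: eqP => //= u0 _; split=> //; lia.
  move=> u; rewrite inE -/(b u) => uV ub u0; rewrite uV u0 ub /=.
  have -> : odd (b v).-1 = false by lia.
  by split=> //; apply/eqP; lia.
have -> : (b v)./2.*2.+1 = (b v).+1 by lia.
have -> : (b v)./2.*2 = b v by lia.
rewrite (@chan_block _ _ h (b v).+1); first by rewrite addn0.
  move=> u; rewrite inE -/(b u) => /andP[uV /eqP ubv].
  case obu: (odd (b u)) => //=; case: eqP => //= u0 _; split=> //; lia.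
move=> u; rewrite inE -/(b u) => uV ub u0; rewrite uV u0 ub /= ob.
by split=> //; apply/eqP; lia.
Qed.

Lemma energy_census_body h c v : v \in V ->
  energy V (fun v => census_body Q (id v) h (c v)) v <= 2.
Proof.
move=> vV; rewrite /census_body !energy_bind /= addn0.
apply: (@leq_add _ _ 1 1); apply: leq_trans (energy_round _ _ _ vV) (leq_b1 _).
Qed.

Lemma run_census lam :
  {in V, forall v,
   run V (fun v => loop (census_body Q (id v)) lam 0 (0, 1)) v =
     (below lam v, #|block lam (id v %/ 2 ^ lam)|) /\
   energy V (fun v => loop (census_body Q (id v)) lam 0 (0, 1)) v <= lam * 2}.
Proof.
move=> v vV.
have E0 : {in V, (fun v => loop (census_body Q (id v)) lam 0 (0, 1)) =1
    (fun v => loop (census_body Q (id v)) lam 0 (below 0 v, #|block 0 (id v %/ 2 ^ 0)|))}.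
  move=> u uV; congr (loop _ _ _ (_, _)).
    apply/esym/eqP; rewrite cards_eq0; apply/eqP/setP => w; rewrite !inE expn0 !divn1.
    by apply/negbTE/negP => /andP[/andP[_ /eqP->]]; rewrite ltnn.
  rewrite (_ : block _ _ = [set u]) ?cards1 //; apply/setP => w.
  rewrite !inE expn0 !divn1; apply/andP/eqP => [[wV /eqP]|->]; last by rewrite eqxx.
  exact: idI.
rewrite (eq_in_run E0 vV) (eq_in_energy E0 vV).
have [-> ->] := @run_loop I _ _ V (fun v => census_body Q (id v))
  (fun h v => (below h v, #|block h (id v %/ 2 ^ h)|)) lam
  (fun h _ => @run_census_body h) v vV.
split=> //; rewrite -[lam in leqRHS]card_ord -sum_nat_const.
by apply: leq_sum => i _; apply: energy_census_body.
Qed.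

Section Tokens.
Variables (lam H : nat).

Let g v := id v %/ 2 ^ lam.
Let valid v := H < #|block lam (g v)|.

(** For a valid [v], its block is the leftmost valid one below their common node at level [i] of the
    tree of blocks. *)
Definition minimal i v :=
  [forall u in V, valid u ==> (g u %/ 2 ^ i == g v %/ 2 ^ i) ==> (g v <= g u)].
Definition rep i v := [&& below lam v == i, valid v & minimal i v].

Lemma minimalP i v : reflect
  {in V, forall u, valid u -> g u %/ 2 ^ i = g v %/ 2 ^ i -> g v <= g u} (minimal i v).
Proof.
apply: (iffP 'forall_implyP) => [M u uV uv|M u uV].
  by move=> /eqP guv; move: (M u uV); rewrite uv guv.
by apply/implyP => uv; apply/implyP => /eqP; apply: M.
Qed.

Lemma rep_unique i : {in V &, forall u v, rep i u -> rep i v ->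
  g u %/ 2 ^ i = g v %/ 2 ^ i -> u = v}.
Proof.
move=> u v uV vV /and3P[/eqP ru vu mu] /and3P[/eqP rv vv mv] E.
apply: (@below_inj lam) => //; last by rewrite ru rv.
apply/eqP; rewrite -/(g u) -/(g v) eqn_leq.
by rewrite (minimalP _ _ mu) // (minimalP _ _ mv).
Qed.

Lemma rep_exists i v : i <= H -> v \in V -> valid v ->
  exists2 u, u \in V & rep i u /\ g u %/ 2 ^ i = g v %/ 2 ^ i.
Proof.
move=> iH vV vv.
pose P := [pred u | [&& u \in V, valid u & g u %/ 2 ^ i == g v %/ 2 ^ i]].
have Pv : P v by rewrite /= vV vv eqxx.
case: (arg_minnP g Pv) => w /and3P[wV ww /eqP gwv] wmin.
have [|u uV [gu bu]] := @below_surj lam w i; first by apply: leq_ltn_trans ww.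
exists u => //; have {}gu : g u = g w := gu; split; last by rewrite gu.
apply/and3P; split; rewrite ?bu //; first by rewrite /valid gu.
apply/minimalP => x xV vx; rewrite gu gwv => /eqP xv.
by apply: wmin; rewrite /= xV vx xv.
Qed.

(** By [rep_exists] and [rep_unique] exactly one device transmits when the subtree holds a valid
    block, so silence certifies that it holds none. *)
Lemma rep_chan i v (W : {set I}) (a : I -> op) b : i <= H -> v \in V ->
  {in W, forall u, sends (a u) -> [/\ u \in V, rep i u & g u %/ 2 ^ i = b]} ->
  {in V, forall u, rep i u -> g u %/ 2 ^ i = b -> u \in W /\ a u = Send (g u)} ->
  (exists u, [/\ u \in V, rep i u, g u %/ 2 ^ i = b & chan W a = Received (g u)]) \/
  ({in V, forall u, valid u -> g u %/ 2 ^ i != b} /\ chan W a = Silence).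
Proof.
move=> iH vV Ws Va.
have [/existsP[w /and3P[wV vw /eqP wb]]|/existsPn none] :=
  boolP [exists w, [&& w \in V, valid w & g w %/ 2 ^ i == b]].
  have [u uV [ru gu]] := rep_exists iH wV vw; left; exists u.
  have [uW au] := Va u uV ru (etrans gu wb); split=> //; first by rewrite gu.
  apply: chan_single uW au _ => x xW /(Ws x xW)[xV rx gx].
  by apply: (rep_unique xV uV rx ru); rewrite gx gu.
right; split.
  by move=> u uV vu; apply/negP => ub; move: (none u); rewrite uV vu ub.
apply: chan_silent => u uW; apply/negP => /(Ws u uW)[uV /and3P[_ vu _] gu].
by move: (none u); rewrite uV vu gu eqxx.
Qed.

Lemma run_token_body i : i < H ->
  {in V, run V (fun v => token_body Q (g v) (below lam v) i (rep i v)) =1 rep i.+1}.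
Proof.
move=> iH v vV; rewrite /token_body run_bind run_bind /=.
set b := fun u => g u %/ 2 ^ i.
have gQ u : g u %/ 2 ^ i < Q.
  exact: leq_ltn_trans (leq_div _ _) (idQ_div _ _).
rewrite !run_round // -!/(b _); last first.
  by apply: leq_ltn_trans (gQ v); case: ifP; rewrite // leq_pred.
rewrite [RHS]/rep; case: eqP => //= bv.
(* A device of rank [i + 1] does not represent its block at level [i], so it is free to listen. *)
have nrep : rep i v = false by rewrite /rep bv; apply/negbTE; rewrite negb_and; lia.
rewrite nrep /=.
set W1 := [set u in V | b u == b v]; set a1 := fun u => if rep i u then Send _ else _.
have := @rep_chan i v W1 a1 (b v) (ltnW iH) vV.
case=> [u|u uV ru|[w [wV rw gw ->]]|[none ->]] /=.
- rewrite inE /a1 => /andP[uV /eqP ub]; case: (rep i u); last by case: ifP.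
  by [].
- by move=> ub; rewrite /W1 /a1 inE uV ru /b ub eqxx.
- have [vw mw] : valid w /\ minimal i w by move: rw; case/and3P.
  (* If another block is announced, the block of [v] is already beaten at level [i], hence also at
     level [i + 1]. *)
  case: eqP => [gwv|gwv] /=; last first.
    apply/esym/negbTE; rewrite negb_and.
    case vv: (valid v) => //=; apply/negP => /minimalP mv; apply: gwv.
    by apply/eqP; rewrite eqn_leq (minimalP _ _ mw) //= mv // !divn_expS gw -/(b v).
  have vv : valid v by rewrite /valid -gwv.
  rewrite vv /=.
  (* In a left subtree the sibling lies to the right and cannot contain a smaller block. *)
  case ob: (odd (b v)) => /=; last first.
    apply/esym/minimalP => u uV vu; rewrite -gwv !divn_expS -/(b u) gw => ubv.
    have : b u = b v \/ b v < b u.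
      by move: ob ubv; move: (b u) (b v) => x y; clear; lia.
    case=> [ub|lt]; first by apply: (minimalP _ _ mw) => //; rewrite -/(b u) ub gw.
    rewrite leqNgt; apply/negP => /ltnW /(leq_div2r (2 ^ i)).
    by rewrite -/(b u) gw leqNgt lt.
  (* In a right subtree [v] listens to the left sibling, and any block announced there is smaller
     than its own. *)
  set W2 := [set u in V | _]; set a2 := fun u => if rep i u then Send _ else _.
  have := @rep_chan i v W2 a2 (b v).-1 (ltnW iH) vV.
  case=> [u|u uV ru|[x [xV rx gx ->]]|[none ->]] /=.
  + rewrite inE /a2 => /andP[uV]; case: (rep i u); last by case: ifP.
    by move=> /eqP ub _.
  + by move=> ub; rewrite /W2 /a2 inE uV ru /b ub eqxx.
  + apply/esym/negP => /minimalP /(_ x xV); case/and3P: (rx) => _ vx _.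
    move=> /(_ vx); rewrite !divn_expS -/(b v) gx => H1.
    have {}H1 : g v <= g x.
      by apply: H1; move: ob; move: (b v) => y; clear; lia.
    have := leq_div2r (2 ^ i) H1; rewrite -/(b v) gx.
    by move: ob; move: (b v) => y; clear; lia.
  + apply/esym/minimalP => u uV vu; rewrite -gwv !divn_expS -/(b u) gw => ubv.
    have ub : b u = b v.
      have := none u uV vu; rewrite -/(b u).
      by move: ob ubv; move: (b u) (b v) => x' y; clear; lia.
    by apply: (minimalP _ _ mw) => //; rewrite -/(b u) ub gw.
apply/esym/negbTE; rewrite negb_and; case vv: (valid v) => //=.
by have := none v vV vv; rewrite eqxx.
Qed.

(** A device acts only at the levels where its rank is [i] or [i + 1], in at most two slots each. *)
Lemma energy_token_body i v : v \in V ->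
  energy V (fun v => token_body Q (g v) (below lam v) i (rep i v)) v <=
  ((below lam v == i) + (below lam v == i.+1)) * 2.
Proof.
move=> vV; rewrite /token_body !energy_bind /= addn0 muln2 -addnn.
have rE : rep i v -> below lam v == i by case/and3P.
apply: leq_add; apply: leq_trans (energy_round _ _ _ vV) _.
  case: ifP => [/rE->|_] //; by case: ifP => // _; exact: leq_addl.
case: ifP => [/rE->|_] //; case: ifP => // /andP[-> _]; exact: leq_addl.
Qed.

Lemma run_tokens : {in V, forall v,
  run V (fun v => loop (token_body Q (g v) (below lam v)) H 0 (rep 0 v)) v = rep H v /\
  energy V (fun v => loop (token_body Q (g v) (below lam v)) H 0 (rep 0 v)) v <= 4}.
Proof.
move=> v vV.
have [-> ->] := @run_loop I _ _ V (fun v => token_body Q (g v) (below lam v))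
  rep H run_token_body v vV.
split=> //; apply: (@leq_trans (\sum_(i < H) ((below lam v == i) + (below lam v == i.+1)) * 2)).
  by apply: leq_sum => i _; apply: energy_token_body.
rewrite -big_distrl -[4]/(2 * 2) leq_mul2r /= big_split.
have S1 (f : nat -> nat) : injective f -> \sum_(i < H) (below lam v == f i) <= 1.
  move=> fI; rewrite (eq_bigr (fun i : 'I_H => if below lam v == f i then 1 else 0)) //.
  rewrite -big_mkcond sum1_card; apply/card_le1_eqP => i j /eqP-> /eqP /fI.
  by move/val_inj.
by apply: (@leq_add _ _ 1 1); [apply: (S1 (fun n => n)) | apply: (S1 succn succn_inj)].
Qed.
End Tokens.
End Dense.

Definition has_leader (I : finType) (V : {set I}) (out : I -> bool) :=
  exists2 l, l \in V & out l.
Definition one_leader (I : finType) (V : {set I}) (out : I -> bool) :=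
  {in V &, forall u v, out u -> out v -> u = v}.

Lemma dense_prog_correct (I : finType) (V : {set I}) lam H (id : I -> nat) :
  {in V &, injective id} -> (forall v, id v < 2 ^ (lam + H)) ->
  let out := run V (fun v => dense_prog lam H (id v)) in
  [/\ one_leader V out,
      {in V, forall v, energy V (fun v => dense_prog lam H (id v)) v <= lam * 2 + 4} &
      {in V, forall v, H < #|block V id lam (id v %/ 2 ^ lam)| -> has_leader V out}].
Proof.
move=> idI idQ out; set Q := 2 ^ (lam + H) in idQ.
pose p v := loop (token_body Q (id v %/ 2 ^ lam) (below V id lam v)) H 0
   (rep V id lam H 0 v).
have Ep : {in V, (fun v => loop (token_body Q (id v %/ 2 ^ lam)
     (run V (fun v => loop (census_body Q (id v)) lam 0 (0, 1)) v).1) H 0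
   (((run V (fun v => loop (census_body Q (id v)) lam 0 (0, 1)) v).1 == 0) &&
    (H < (run V (fun v => loop (census_body Q (id v)) lam 0 (0, 1)) v).2))) =1 p}.
  move=> v vV; rewrite (proj1 (run_census idI idQ lam vV)) /p; congr loop.
  rewrite /rep /=; case: eqP => //= _; case: (ltnP H) => //= _.
  apply/esym/minimalP => u uV _; rewrite expn0 !divn1 => <- //.
have outE : {in V, out =1 rep V id lam H H}.
  move=> v vV; rewrite /out /dense_prog -/Q run_bind (eq_in_run Ep vV).
  by have [->] := run_tokens idI idQ lam H vV.
(* After [H] levels a single subtree remains, so representatives are unique among all devices. *)
have top v : id v %/ 2 ^ lam %/ 2 ^ H = 0.
  by rewrite -divnMA -expnD divn_small.
split.
- move=> u v uV vV; rewrite !outE //; move=> ru rv.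
  by apply: (rep_unique idI uV vV ru rv); rewrite !top.
- move=> v vV; rewrite /dense_prog -/Q energy_bind (eq_in_energy Ep vV).
  apply: leq_add; first by have [] := run_census idI idQ lam vV.
  by have [] := run_tokens idI idQ lam H vV.
- move=> v vV vv; have [u uV [ru _]] := rep_exists idI (leqnn H) vV vv.
  by exists u => //; rewrite outE.
Qed.

(** * Plans: composing elections over shrinking identifier spaces *)

(* In [Node h P1 P2] every device transmits in slot [h id]; those that are alone
   in their slot run [P1] with [h id] as identifier, while the others wait and
   run [P2] only if no leader of [P1] announces itself. *)
Inductive plan : nat -> Type :=
  | Stop A : plan A
  | Dense lam H : plan (2 ^ (lam + H))
  | Node A B (h : 'I_A -> 'I_B) (P1 : plan B) (P2 : plan A) : plan A.
Arguments Stop {A}.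

Fixpoint plan_time A (P : plan A) : nat :=
  match P with
  | Stop _ => 0
  | Dense lam H => dense_time lam H
  | Node _ B _ P1 P2 => B + (plan_time P1 + (1 + plan_time P2))
  end.

(** A device takes part in only one of the two subplans, hence [maxn]; the 2 pays for the slot of
    [h] and for the announcement. *)
Fixpoint plan_energy A (P : plan A) : nat :=
  match P with
  | Stop _ => 0
  | Dense lam _ => lam * 2 + 4
  | Node _ _ _ P1 P2 => 2 + maxn (plan_energy P1) (plan_energy P2)
  end.

Fixpoint plan_prog A (P : plan A) : 'I_A -> prog bool (plan_time P) :=
  match P with
  | Stop _ => fun=> false
  | Dense lam H => fun id => dense_prog lam H id
  | Node _ B h P1 P2 => fun id =>
      bind (round B (h id) (Send 0)) (fun f =>
      bind (if received f then plan_prog P1 (h id) else pure _ false) (fun l =>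
      bind (round 1 0 (if received f then if l then Send 0 else Sleep else Hear))
        (fun f' => if received f || received f' then pure _ l else plan_prog P2 id)))
  end.

Section Plans.
Variable I : finType.
Implicit Type V : {set I}.

Definition solo (J : eqType) (f : I -> J) V : {set I} :=
  [set v in V | [forall u in V, (f u == f v) ==> (u == v)]].

Lemma solo_sub (J : eqType) (f : I -> J) V : solo f V \subset V.
Proof. by apply/subsetP => v; rewrite inE => /andP[]. Qed.

Lemma soloP (J : eqType) (f : I -> J) V v :
  reflect (v \in V /\ {in V, forall u, f u = f v -> u = v}) (v \in solo f V).
Proof.
rewrite inE; apply: (iffP andP) => -[vV F]; split=> //.
  by move=> u uV /eqP uv; apply/eqP; have /implyP/(_ uV)/implyP := forallP F u; apply.
by apply/forall_inP => u uV; apply/implyP => /eqP /(F u uV) ->.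
Qed.

(** A sufficient condition for success that does not mention executions. Devices alone under [h]
    never take part in [P2]. *)
Fixpoint elects A (P : plan A) V : (I -> 'I_A) -> Prop :=
  match P with
  | Stop _ => fun=> False
  | Dense lam H => fun id =>
      exists2 v, v \in V & H < #|block V id lam (id v %/ 2 ^ lam)|
  | Node _ _ h P1 P2 => fun id =>
      let W := solo (h \o id) V in
      elects P1 W (h \o id) \/ elects P2 (V :\: W) id
  end.

Lemma received_chan_unit V a : {in V, forall u, sends (a u) -> a u = Send 0} ->
  received (chan V a) = (#|[set u in V | sends (a u)]| == 1).
Proof.
move=> a0; apply/idP/cards1P => [|[v E]].
  have [S0|[v vS]] := set_0Vmem [set u in V | sends (a u)].
    by rewrite (chan_senders (W := set0)) ?chan_silent // ?S0 => [u|];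
       rewrite ?inE //; apply/esym/setP => u; rewrite !inE.
  move=> rc; exists v; apply/setP => u; rewrite in_set1.
  apply/idP/eqP => [uS|->//]; apply/eqP; apply: contraTT rc => uv.
  move: uS vS; rewrite !inE => /andP[uV su] /andP[vV sv].
  by rewrite (chan_collision uV vV uv su sv).
have : v \in [set u in V | sends (a u)] by rewrite E set11.
rewrite inE => /andP[vV sv]; rewrite (chan_single vV (a0 v vV sv)) // => u uV su.
by apply/set1P; rewrite -E inE uV.
Qed.

Lemma run_solo V B (f : I -> 'I_B) : {in V, forall v,
  received (run V (fun v => round B (f v) (Send 0)) v) = (v \in solo f V)}.
Proof.
move=> v vV; rewrite (run_round (s := fun v => nat_of_ord (f v))) //=.
rewrite received_chan_unit //=; apply/cards1P/soloP => [[w E]|[_ F]].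
  have Ew u : u \in V -> f u = f v -> u = w.
    by move=> uV uv; apply/set1P; rewrite -E !inE uV uv eqxx.
  by split=> // u uV uv; rewrite (Ew u) // (Ew v).
exists v; apply/setP => u; rewrite !inE andbT; apply/andP/eqP => [[uV /eqP /val_inj]|->].
  exact: F.
by rewrite vV eqxx.
Qed.

(** Uniqueness of the leader and the energy bound are proved for every [V], since subplans also run
    on sets for which they fail to elect. *)
Theorem plan_correct A (P : plan A) V (id : I -> 'I_A) : {in V &, injective id} ->
  let p := fun v => plan_prog P (id v) in
  [/\ one_leader V (run V p),
      {in V, forall v, energy V p v <= plan_energy P} &
      elects P V id -> has_leader V (run V p)].
Proof.
elim: P V id => [{}A|lam H|{}A B h P1 IH1 P2 IH2] V id idI p.
- by split=> // u v uV vV.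
- have [|//|L E D] := @dense_prog_correct I V lam H id.
    by move=> u v uV vV /val_inj; apply: idI.
  by split=> // -[v vV]; apply: D.
set W := solo (h \o id) V.
have WV : W \subset V by apply: solo_sub.
have idW : {in W &, injective (h \o id)}.
  by move=> u v /soloP[uV _] /soloP[vV F] uv; apply: F.
have idX : {in V :\: W &, injective id}.
  by move=> u v /setDP[uV _] /setDP[vV _]; apply: idI.
have rW : {in V, forall v,
  received (run V (fun v => round B (h (id v)) (Send 0)) v) = (v \in W)}.
  exact: run_solo.
have elW : elects (Node h P1 P2) V id -> elects P1 W (h \o id) \/ elects P2 (V :\: W) id.
  by [].
clearbody W; have [L1 E1 D1] := IH1 W (h \o id) idW; have [L2 E2 D2] := IH2 (V :\: W) id idX.
set out1 := run W _ in L1 D1; set out2 := run (V :\: W) _ in L2 D2.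
(* The later phases are restated with membership in [W] in place of the feedback of the first round,
   as [rW] allows. *)
pose p1 v := if v \in W then plan_prog P1 (h (id v)) else pure (plan_time P1) false.
pose ann v l := round 1 0 (if v \in W then if l then Send 0 else Sleep else Hear).
pose fin v l f := if (v \in W) || received f then pure (plan_time P2) l
  else plan_prog P2 (id v).
have p1W : {in W, forall v, run V p1 v = out1 v /\ energy V p1 v <= plan_energy P1}.
  move=> v vW; have [|-> ->] := @run_sub I _ _ V W p1 (fun=> false) WV _ v vW.
    by move=> u /setDP[_ /negbTE uW]; rewrite /p1 uW.
  have E : {in W, p1 =1 (fun v => plan_prog P1 (h (id v)))} by move=> u uW; rewrite /p1 uW.
  by rewrite (eq_in_run E vW) (eq_in_energy E vW) E1.
have p1X v : v \notin W -> run V p1 v = false /\ energy V p1 v = 0.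
  by move=> vW; apply: run_waiting; rewrite /p1 (negbTE vW).
pose some := [exists v in W, out1 v].
have annE : {in V, forall v, v \notin W ->
   received (run V (fun v => ann v (run V p1 v)) v) = some}.
  move=> v vV vW; rewrite (run_round (s := fun=> 0)) // (negbTE vW) /=.
  rewrite received_chan_unit => [|u _]; last by case: ifP => // _; case: ifP.
  apply/cards1P/exists_inP => [[w E]|[w wW ow]].
    have : w \in [set w] by rewrite set11.
    rewrite -E !inE; case: ifP => [wW|]; last by rewrite andbF.
    by have [-> _] := p1W w wW; case: ifP => [ow _|]; [exists w | rewrite andbF].
  exists w; apply/setP => u; rewrite !inE andbT; apply/andP/eqP => [[uV]|->].
    case: ifP => // uW; have [-> _] := p1W u uW; case: ifP => // ou _.
    exact: L1.
  by have [-> _] := p1W w wW; rewrite wW ow (subsetP WV).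
have runE : {in V, forall v, run V p v =
   run V (fun v => fin v (run V p1 v) (run V (fun v => ann v (run V p1 v)) v)) v}.
  move=> v vV; rewrite /p /= run_bind.
  rewrite (eq_in_run (q := fun v => bind (p1 v) (fun l => bind (ann v l) (fin v l))) _ vV).
    by rewrite !run_bind.
  by move=> u uV; rewrite rW.
have energyE : {in V, forall v, energy V p v <= 1 + (energy V p1 v +
   ((v \notin W) || run V p1 v +
   energy V (fun v => fin v (run V p1 v) (run V (fun v => ann v (run V p1 v)) v)) v))}.
  move=> v vV; rewrite /p /= energy_bind.
  rewrite (eq_in_energy (q := fun v => bind (p1 v) (fun l => bind (ann v l) (fin v l))) _ vV);
    last by move=> u uV; rewrite rW.
  apply: leq_add; first exact: energy_round.
  rewrite !energy_bind leq_add2l leq_add2r /ann.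
  by apply: leq_trans (energy_round _ _ _ vV) _; case: (v \in W) => //; case: (run V p1 v).
have finW : {in W, forall v, run V p v = out1 v /\ energy V p v <= plan_energy (Node h P1 P2)}.
  move=> v vW; have vV := subsetP WV v vW; have [o1 e1] := p1W v vW.
  have [] := @run_waiting I bool (plan_time P2) V
    (fun v => fin v (run V p1 v) (run V (fun v => ann v (run V p1 v)) v)) v (run V p1 v).
    by rewrite /fin vW.
  move=> rv ev; rewrite runE // rv o1; split=> //.
  apply: leq_trans (energyE v vV) _; rewrite ev vW /=.
  rewrite addn0 -[2]/(1 + 1) -addnA leq_add2l addnC leq_add ?leq_b1 //.
  by rewrite (leq_trans e1) ?leq_maxl.
have finX : {in V :\: W, forall v, run V p v = ~~ some && out2 v /\
    energy V p v <= plan_energy (Node h P1 P2)}.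
  move=> v vX; have /setDP[vV vW] := vX; have [o1 e1] := p1X v vW.
  have := energyE v vV; rewrite runE // e1 vW /=.
  set q := fun v => fin v _ _; case: (boolP some) => so /=.
    have [] := @run_waiting I bool (plan_time P2) V q v false.
      by rewrite /q /fin annE // so orbT o1.
    by move=> -> -> le; split=> //; apply: leq_trans le _; lia.
  have XV : V :\: W \subset V by apply: subsetDl.
  have [|-> ->] := @run_sub I _ _ V (V :\: W) q (run V p1) XV _ v vX.
    move=> u /setDP[uV]; rewrite inE uV andbT negbK => uW.
    by rewrite /q /fin uW.
  have E : {in V :\: W, q =1 fun v => plan_prog P2 (id v)}.
    by move=> u /setDP[uV uW]; rewrite /q /fin annE // (negbTE so) (negbTE uW).
  rewrite (eq_in_run E vX) (eq_in_energy E vX) => le; split=> //.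
  by apply: leq_trans le _; rewrite !leq_add2l (leq_trans (E2 v vX)) ?leq_maxr.
have WX v : v \in V -> v \in W \/ v \in V :\: W.
  by move=> vV; rewrite inE vV andbT; case: (v \in W); [left|right].
split.
- move=> u v uV vV; case: (WX u uV) => uW; case: (WX v vV) => vW.
  + by rewrite (proj1 (finW u uW)) (proj1 (finW v vW)); apply: L1.
  + rewrite (proj1 (finW u uW)) (proj1 (finX v vW)) => ou /andP[/exists_inPn so _].
    by have := so u uW; rewrite ou.
  + rewrite (proj1 (finX u uW)) (proj1 (finW v vW)) => /andP[/exists_inPn so _] ov.
    by have := so v vW; rewrite ov.
  + rewrite (proj1 (finX u uW)) (proj1 (finX v vW)) => /andP[_ ou] /andP[_ ov].
    exact: L2.
- move=> v vV; case: (WX v vV) => vW; [exact: (proj2 (finW v vW))|].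
  exact: (proj2 (finX v vW)).
- move=> /elW el; case: (boolP some) => [/exists_inP[l lW ol]|so].
    by exists l; [apply: (subsetP WV) | rewrite (proj1 (finW l lW))].
  case: el => [/D1[l lW ol]|/D2[l lX ol]].
    by move/exists_inPn: so => /(_ l lW); rewrite ol.
  exists l; first by move/setDP: lX => [].
  by rewrite (proj1 (finX l lX)) so ol.
Qed.
End Plans.

Lemma plan_solves N n (P : plan N) :
  (forall V : {set 'I_N}, admissible n V -> elects P V id) ->
  let alg := algorithm_of (plan_prog P) in
  [/\ solves_leader_election n alg,
      time_complexity_le n alg (plan_time P) &
      energy_complexity_le n alg (plan_energy P)].
Proof.
move=> el alg.
have pc V := @plan_correct 'I_N N P V id (in2W (@inj_id _)).
split.
- move=> V adm; have [L _ /(_ (el V adm)) [l lV ol]] := pc V.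
  exists (plan_time P); exists l => // v vV; rewrite output_algorithm_of.
  congr Some; apply/idP/eqP => [ov|->//]; exact: L.
- by move=> V adm v vV; rewrite output_algorithm_of.
- move=> V adm v vV t; have [_ E _] := pc V.
  exact: leq_trans (energy_algorithm_of _ _ _ _) (E v vV).
Qed.

(** * Existence of maps that leave many elements alone, by counting *)

Lemma bin_le_exp2 n k : 'C(n, k) <= 2 ^ n.
Proof.
elim: n k => [|n IH] [|k]; rewrite ?bin0 ?expn_gt0 // binS expnS mul2n -addnn.
by rewrite leq_add.
Qed.

(** Since [k ^ k <= (k + k) ^_ k] and ['C(k + k, k) <= 4 ^ k], the factorial of [k] is at least
    [(k / 4) ^ k]. *)
Lemma bin_expn_le n k : 'C(n, k) * k ^ k <= (4 * n) ^ k.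
Proof.
have k4 : k ^ k <= 4 ^ k * k`!.
  apply: (@leq_trans ((k + k) ^_ k)).
    suff H j : j <= k -> k ^ j <= (k + k) ^_ j by apply: H.
    elim: j => [|j IH] jk; first by rewrite ffactn0.
    by rewrite expnSr ffactnSr; apply: leq_mul; [apply: IH|]; lia.
  by rewrite -bin_ffact leq_mul2r -[4]/(2 ^ 2) -expnM mul2n -addnn bin_le_exp2 orbT.
apply: leq_trans (leq_mul (leqnn _) k4) _.
rewrite mulnCA bin_ffact expnMn leq_mul2l; apply/orP; right.
elim: k {k4} => // k IH; rewrite ffactnSr expnSr.
by apply: leq_mul; rewrite ?leq_subr.
Qed.

Lemma card_bigcup_le (J T : finType) (P : pred J) (F : J -> {set T}) :
  #|\bigcup_(j | P j) F j| <= \sum_(j | P j) #|F j|.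
Proof.
apply: (big_ind2 (fun (X : {set T}) n => #|X| <= n)) => //; first by rewrite cards0.
by move=> X m Y n Xm Yn; apply: leq_trans (leq_card_setU X Y) (leq_add Xm Yn).
Qed.

Lemma superset_card (T : finType) (W : {set T}) n :
  #|W| <= n <= #|T| -> exists2 W' : {set T}, W \subset W' & #|W'| = n.
Proof.
move=> /andP[Wn nT]; elim: n Wn nT => [|n IH] Wn nT.
  by exists W => //; lia.
case: (ltngtP #|W| n.+1) Wn => // [Wn _|E _]; last by exists W.
have [|W' WW' W'n] := IH Wn; first lia.
have /existsP[x xW'] : [exists x, x \notin W'].
  apply: contraTT nT => /existsPn all; rewrite -leqNgt -W'n subset_leq_card //.
  by apply/subsetP => x _; have := all x; rewrite negbK.
exists (x |: W'); first exact: subset_trans WW' (subsetUr _ _).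
by rewrite cardsU1 xW' W'n.
Qed.

(** Fibre by fibre: a singleton fibre contributes 1 to both terms on the right, and a larger one at
    least 2 to [#|S|]. *)
Lemma card_image_solo (T U : finType) (f : T -> U) (S : {set T}) :
  2 * #|f @: S| <= #|S| + #|solo f S|.
Proof.
have part (X : {set T}) : X \subset S ->
    #|X| = \sum_(y in f @: S) #|[set x in X | f x == y]|.
  move=> XS; rewrite -sum1_card (partition_big f (mem (f @: S))) /=.
    by apply: eq_bigr => y _; rewrite -sum1_card; apply: eq_bigl => x; rewrite inE.
  by move=> x xX; apply: imset_f; apply: (subsetP XS).
rewrite {1}(part S) // (part _ (solo_sub f S)) -big_split mulnC -sum_nat_const.
apply: leq_sum => y /imsetP[x xS yx].
have xy : x \in [set x in S | f x == y] by rewrite inE xS yx eqxx.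
have [le|gt] := leqP #|[set x in S | f x == y]| 1; last exact: leq_trans gt (leq_addr _ _).
apply: (@leq_add 1 1); apply/card_gt0P; exists x => //.
rewrite inE yx eqxx andbT; apply/soloP; split=> // u uS fu.
by apply: (card_le1_eqP le) => //; rewrite inE uS yx fu eqxx.
Qed.

Section Expander.
Variables (A B : nat).
Implicit Types (S : {set 'I_A}) (W : {set 'I_B}) (f : {ffun 'I_A -> 'I_B}).

Lemma card_maps_into S W :
  #|[set f : {ffun 'I_A -> 'I_B} | f @: S \subset W]| = #|W| ^ #|S| * B ^ (A - #|S|).
Proof.
pose F (x : 'I_A) : pred 'I_B := [pred y | (x \in S) ==> (y \in W)].
rewrite (_ : #|_| = #|(family F : pred {ffun 'I_A -> 'I_B})|); last first.
  apply: eq_card => f; rewrite inE; apply/subsetP/familyP => [fW x|fF y].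
    by rewrite inE; apply/implyP => xS; apply/fW/imset_f.
  by move=> /imsetP[x xS ->]; have := fF x; rewrite inE xS.
rewrite card_family foldrE big_map big_enum /= (bigID (mem S)) /=.
congr (_ * _).
  rewrite (eq_bigr (fun=> #|W|)) ?prod_nat_const // => x xS.
  by apply: eq_card => y; rewrite inE (xS : x \in S).
rewrite (eq_bigr (fun=> B)) => [|x /negbTE xS]; last first.
  by rewrite -[RHS]card_ord; apply: eq_card => y; rewrite inE (xS : x \in S = false).
rewrite prod_nat_const; congr (_ ^ _).
have SA : #|S| <= A by rewrite -[leqRHS]card_ord max_card.
apply: (@addnI #|S|); rewrite (subnKC SA) -[RHS]card_ord -(cardC (mem S)).
by congr addn; apply: eq_card.
Qed.

Definition crowded S := [set f : {ffun 'I_A -> 'I_B} | 2 * #|solo f S| < #|S|].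

(* A crowded map sends [S] into one of the sets of size [3/4 #|S|]. *)
Lemma card_crowded S : #|S| <= B ->
  #|crowded S| ^ 4 * B ^ #|S| <= (256 * #|S|) ^ #|S| * (B ^ A) ^ 4.
Proof.
set s := #|S| => sB; have sA : s <= A by rewrite -[leqRHS]card_ord max_card.
have [s0|s_gt0] := posnP s.
  rewrite s0 !expn0 !muln1 mul1n leq_exp2r // (leq_trans (max_card _)) //.
  by rewrite card_ffun !card_ord.
(* By [card_image_solo] a crowded map has [4 * #|f @: S| < 3 * s], so its image fits in a set of [w]
   elements. *)
have [w [w34 ws sw4]] : exists w, [/\ w = (3 * s) %/ 4, w <= s & s <= 4 * (s - w)].
  by exists ((3 * s) %/ 4); split; lia.
have le1 : #|crowded S| <= 'C(B, w) * (w ^ s * B ^ (A - s)).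
  have sub : crowded S \subset \bigcup_(W : {set 'I_B} | #|W| == w)
      [set f : {ffun 'I_A -> 'I_B} | f @: S \subset W].
    apply/subsetP => f; rewrite inE -/s => fS.
    have [|W fW Ww] := @superset_card _ (f @: S) w.
      rewrite card_ord (leq_trans ws sB) andbT.
      move: fS (card_image_solo f S); rewrite -/s w34.
      by move: #|solo f S| #|f @: S| => a b; lia.
    by apply/bigcupP; exists W; rewrite ?Ww // inE.
  apply: leq_trans (subset_leq_card sub) (leq_trans (card_bigcup_le _ _) _).
  rewrite (eq_bigr (fun=> w ^ s * B ^ (A - s))) => [|W /eqP Ww]; last first.
    by rewrite card_maps_into Ww.
  by rewrite sum_nat_const -cardsE card_draws card_ord.
have le2 : #|crowded S| * B ^ (s - w) <= 4 ^ s * (s ^ (s - w) * B ^ A).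
  apply: leq_trans (leq_mul le1 (leqnn _)) _.
  have -> : 'C(B, w) * (w ^ s * B ^ (A - s)) * B ^ (s - w) =
    ('C(B, w) * w ^ w) * (w ^ (s - w) * B ^ (A - w)).
    have -> : A - w = (A - s) + (s - w) by lia.
    rewrite -[in w ^ s](subnKC ws) !expnD.
    by move: 'C(B, w) (w ^ w) (w ^ (s - w)) (B ^ _) (B ^ _) => a b c d e; nia.
  apply: leq_trans (leq_mul (bin_expn_le B w) (leqnn _)) _.
  have -> : (4 * B) ^ w * (w ^ (s - w) * B ^ (A - w)) =
     4 ^ w * (w ^ (s - w) * B ^ A).
    have Aw : w + (A - w) = A by lia.
    rewrite -[in RHS]Aw expnMn expnD.
    by move: (4 ^ w) (B ^ w) (w ^ _) (B ^ _) => a b c d; nia.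
  apply: leq_mul; first by rewrite leq_exp2l.
  by rewrite leq_mul2r; case: (s - w) => [|j]; rewrite ?leqnn ?orbT // leq_exp2r // ws orbT.
(* The fourth power of [le2] has [B ^ (s + c)] on the left and [s ^ (s + c)] on the right; as
   [s <= B], the surplus [s ^ c] cancels against [B ^ c]. *)
set c := 4 * (s - w) - s.
have Bc : 0 < B ^ c by rewrite expn_gt0 (leq_trans s_gt0 sB).
rewrite -(leq_pmul2r Bc) -mulnA -expnD.
have -> : s + c = (s - w) * 4 by rewrite /c; lia.
rewrite expnM -expnMn.
apply: (@leq_trans ((4 ^ s * (s ^ (s - w) * B ^ A)) ^ 4)); first by rewrite leq_exp2r.
rewrite !expnMn -!expnM.
have -> : (s - w) * 4 = s + c by rewrite /c; lia.
rewrite expnD (mulnC s 4) expnM -[4 ^ 4]/256.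
have : s ^ c <= B ^ c by case: (c) => // j; rewrite leq_exp2r.
set X := 256 ^ s; set Y := s ^ s; set Z := B ^ (A * 4) => le.
have -> : X * (Y * s ^ c * Z) = X * Y * Z * s ^ c.
  by move: (s ^ c) (X) (Y) (Z) => a b d e; nia.
by rewrite leq_mul2l le orbT.
Qed.
End Expander.

(** The sum is at most [X * (1 - 2 ^ -n)]; the induction proves this cleared of denominators. *)
Lemma sum_geometric_lt (x : nat -> nat) X n : 0 < X ->
  (forall i, i < n -> x i * 2 ^ i.+1 <= X) -> \sum_(i < n) x i < X.
Proof.
move=> X_gt0 Hx.
suff : (\sum_(i < n) x i) * 2 ^ n + X <= X * 2 ^ n.
  by move: (2 ^ n) (\sum_(_ < _) _) => p s; nia.
elim: n Hx => [|n IH] Hx; first by rewrite big_ord0 expn0; lia.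
have {}IH := IH (fun i im => Hx i (ltnW im)).
have := Hx n (ltnSn n); rewrite big_ord_recr /= !expnS.
by move: (2 ^ n) (\sum_(_ < _) _) (x n) IH => p s y; nia.
Qed.

Section UniqueNeighbours.
Variables (A B d t : nat).
Hypotheses (B_gt0 : 0 < B) (d_gt0 : 0 < d) (HAB : 16 * 256 ^ d * A * t ^ d.-1 <= B ^ d).

(** The number of families of [4 * d] maps; the 4 matches the fourth power in [card_crowded]. *)
Let Tot := (B ^ A) ^ (4 * d).

Lemma expander_size s : s <= t -> 0 < s <= A ->
  s <= B /\ 16 * A * (256 * s) ^ d <= s * B ^ d.
Proof.
move=> st /andP[s_gt0 sA].
have le : 16 * 256 ^ d * A * s ^ d.-1 <= B ^ d.
  apply: leq_trans HAB; rewrite leq_mul2l; case: d.-1 => [|j]; first by rewrite leqnn orbT.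
  by rewrite leq_exp2r // st orbT.
have sd : s ^ d = s * s ^ d.-1 by rewrite -expnS prednK.
have E : s * (16 * 256 ^ d * A * s ^ d.-1) = 16 * A * (256 * s) ^ d.
  by rewrite expnMn sd; move: (256 ^ d) (s ^ _) => a b; nia.
split; last by rewrite -E leq_mul2l le orbT.
rewrite -(leq_exp2r _ _ d_gt0) sd; apply: leq_trans le.
rewrite leq_mul2r; apply/orP; right.
have : 0 < 256 ^ d by rewrite expn_gt0.
by move: (256 ^ d) => a; nia.
Qed.

(** Union bound over the sets of size [s]: by [bin_expn_le] there are at most [(4 * A / s) ^ s] of
    them, and [expander_size] leaves a factor [4 ^ s] to spare. *)
Lemma sum_crowded_le s : s <= t -> 0 < s ->
  (\sum_(S : {set 'I_A} | #|S| == s) #|crowded B S| ^ (4 * d)) * 4 ^ s <= Tot.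
Proof.
move=> st s_gt0; have [sA|As] := leqP s A; last first.
  rewrite big_pred0 // => S; apply/negbTE; rewrite neq_ltn (leq_ltn_trans _ As) //.
  by rewrite -[leqRHS]card_ord max_card.
have [|sB le] := expander_size st; first by rewrite s_gt0.
have Sle (S : {set 'I_A}) : #|S| == s ->
    #|crowded B S| ^ (4 * d) * (B ^ d) ^ s <= ((256 * s) ^ d) ^ s * Tot.
  move=> /eqP Ss; have := @card_crowded A B S; rewrite Ss => /(_ sB).
  rewrite -(leq_exp2r _ _ d_gt0) expnMn [leqRHS]expnMn -!(expnM _ 4 d).
  by rewrite [(B ^ s) ^ d]expnAC [(_ ^ s) ^ d]expnAC.
have p_gt0 : 0 < (s * B ^ d) ^ s by rewrite expn_gt0 muln_gt0 s_gt0 expn_gt0 B_gt0.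
rewrite -(leq_pmul2r p_gt0).
have sum_le : (\sum_(S : {set 'I_A} | #|S| == s) #|crowded B S| ^ (4 * d)) * (B ^ d) ^ s
    <= 'C(A, s) * (((256 * s) ^ d) ^ s * Tot).
  rewrite big_distrl /= -[A in 'C(A, _)]card_ord -card_draws -sum1_card big_distrl /=.
  rewrite [leqRHS](eq_bigl (fun S : {set 'I_A} => #|S| == s)); last by move=> S; rewrite inE.
  by apply: leq_sum => S Ss; rewrite mul1n Sle.
set x := \sum_(S | _) _ in sum_le *.
apply: (@leq_trans (4 ^ s * ('C(A, s) * s ^ s) * ((256 * s) ^ d) ^ s * Tot)).
  rewrite expnMn; move: sum_le.
  move: (4 ^ s) (s ^ s) ('C(A, s)) ((B ^ d) ^ s) (((256 * s) ^ d) ^ s) => a b c e g H.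
  have -> : x * a * (b * e) = (a * b) * (x * e) by nia.
  have -> : a * (c * b) * g * Tot = (a * b) * (c * (g * Tot)) by nia.
  by rewrite leq_mul2l H orbT.
rewrite mulnC leq_mul2l; apply/orP; right.
apply: (@leq_trans ((16 * A * (256 * s) ^ d) ^ s)); last by rewrite leq_exp2r.
have -> : (16 * A * (256 * s) ^ d) ^ s = 4 ^ s * (4 * A) ^ s * ((256 * s) ^ d) ^ s.
  by rewrite -!expnMn mulnA.
by rewrite leq_mul2r leq_mul2l bin_expn_le !orbT.
Qed.

(** A family is bad for [S] if all its maps are crowded. Summed over all sizes, the bad families are
    fewer than [Tot], so some family is bad for no [S]. *)
Lemma unique_neighbours : exists h : 'I_(4 * d) -> 'I_A -> 'I_B,
  forall S : {set 'I_A}, 0 < #|S| <= t -> exists j, #|S| <= 2 * #|solo (h j) S|.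
Proof.
have Tot_gt0 : 0 < Tot by rewrite !expn_gt0 B_gt0.
pose bad S := [set h : {ffun 'I_(4 * d) -> {ffun 'I_A -> 'I_B}} |
  [forall j, h j \in crowded B S]].
have card_bad S : #|bad S| = #|crowded B S| ^ (4 * d).
  rewrite -[4 * d in RHS]card_ord -card_ffun_on; apply: eq_card => h.
  by rewrite inE; apply/forallP/ffun_onP.
pose U := \bigcup_(S : {set 'I_A} | 0 < #|S| <= t) bad S.
have U_lt : #|U| < Tot.
  apply: leq_ltn_trans (card_bigcup_le _ _) _.
  rewrite (partition_big (fun S : {set 'I_A} => inord #|S| : 'I_t.+1) xpredT) //=.
  pose x i := \sum_(S : {set 'I_A} | (0 < #|S| <= t) && (#|S| == i)) #|bad S|.
  rewrite (eq_bigr (fun i : 'I_t.+1 => x i)) => [|i _]; last first.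
    apply: eq_bigl => S; case: (boolP (0 < #|S| <= t)) => //= /andP[_ St].
    by rewrite -val_eqE /= inordK.
  apply: sum_geometric_lt => // i it; case: (posnP i) => [->|i_gt0].
    by rewrite /x big_pred0 // => S; case: #|S| => //= n; rewrite andbF.
  apply: leq_trans (sum_crowded_le it i_gt0).
  (* Size 0 has been set aside, and [2 ^ i.+1 <= 4 ^ i] for positive [i]. *)
  apply: leq_mul; last by rewrite -[4]/(2 ^ 2) -expnM leq_exp2l //; lia.
  rewrite /x [leqRHS](bigID (fun S : {set 'I_A} => 0 < #|S| <= t)) /=.
  rewrite (eq_bigl (fun S : {set 'I_A} => (#|S| == i) && (0 < #|S| <= t))); last first.
    by move=> S; rewrite andbC.
  rewrite (eq_bigr (fun S : {set 'I_A} => #|crowded B S| ^ (4 * d))) ?leq_addr //.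
have /set0Pn[h] : ~: U != set0.
  rewrite -card_gt0 -(ltn_add2l #|U|) addn0 cardsC (leq_trans U_lt) // /Tot.
  by rewrite !card_ffun !card_ord.
rewrite inE => hU; exists (fun j x => h j x) => S St.
have : h \notin bad S by apply: contraNN hU => hS; apply/bigcupP; exists S.
rewrite inE => /forallPn[j]; rewrite inE -leqNgt => le; by exists j.
Qed.
End UniqueNeighbours.

(** * From sparse to dense: plans with a density threshold *)

(** Quantifying over the devices and their identifiers allows a subset of the devices to run [P]
    under new identifiers. *)
Definition promises A (P : plan A) (a : nat) :=
  forall (I : finType) (V : {set I}) (id : I -> 'I_A),
  {in V &, injective id} -> a <= #|V| -> elects P V id.

Fixpoint plan_rows (J : Type) A B (h : J -> 'I_A -> 'I_B) (js : seq J)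
    (P1 : plan B) (P2 : plan A) : plan A :=
  if js is j :: js' then Node (h j) P1 (plan_rows h js' P1 P2) else P2.

Lemma plan_rows_time (J : Type) A B (h : J -> 'I_A -> 'I_B) js P1 P2 :
  plan_time (plan_rows h js P1 P2) =
  size js * (B + plan_time P1 + 1) + plan_time P2.
Proof. by elim: js => //= j js ->; rewrite mulSn; lia. Qed.

Lemma plan_rows_energy (J : Type) A B (h : J -> 'I_A -> 'I_B) js P1 P2 E :
  plan_energy P1 <= E -> plan_energy P2 <= E ->
  plan_energy (plan_rows h js P1 P2) <= 2 * size js + E.
Proof. by move=> E1 E2; elim: js => //= j js IH; rewrite mulnS; lia. Qed.

Lemma card_solo_setD (I : finType) (J : eqType) (f : I -> J) (V W : {set I}) :
  #|solo f V| <= #|W| + #|solo f (V :\: W)|.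
Proof.
apply: leq_trans (leq_card_setU _ _); apply/subset_leq_card/subsetP => v.
case/soloP => vV F; rewrite inE; case vW: (v \in W) => //=.
by apply/soloP; split=> [|u /setDP[uV _]]; [rewrite inE vW | apply: F].
Qed.

(** Each failed call removes at most [b] devices. Either a map has so many devices alone that more
    than [b] survive until its turn, or [P2] succeeds on whatever is left. *)
Lemma elects_rows (J : eqType) A B (h : J -> 'I_A -> 'I_B) js P1 P2 b
    (I : finType) (V : {set I}) (id : I -> 'I_A) :
  {in V &, injective id} -> promises P1 b.+1 ->
  (exists2 j, j \in js & size js * b < #|solo (h j \o id) V|) \/
  (forall U : {set I}, U \subset V -> #|V| <= #|U| + size js * b -> elects P2 U id) ->
  elects (plan_rows h js P1 P2) V id.
Proof.
move=> + P1b; elim: js V => [|j js IH] V idI /=.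
  by case=> [[]//|]; apply; rewrite // addn0.
set W := solo (h j \o id) V => H.
have [Wb|bW] := leqP #|W| b; last first.
  by left; apply: P1b => // u v /soloP[uV _] /soloP[vV F]; apply: F.
right; apply: IH => [u v /setDP[uV _] /setDP[vV _]|]; first exact: idI.
case: H => [[j' + le]|H].
  rewrite inE => /orP[/eqP jj'|j'js].
    by move: le; rewrite jj' -/W mulSn; lia.
  left; exists j' => //; have := card_solo_setD (h j' \o id) V W.
  by move: le; rewrite mulSn; lia.
right=> U /subsetDP[UV _] le; apply: H => //.
have := cardsID W V; have := subset_leq_card (subsetIr V W).
by move: le; rewrite mulSn; lia.
Qed.

Lemma solo_neighbours A B (h : 'I_A -> 'I_B) (I : finType) (V : {set I})
    (id : I -> 'I_A) :
  {in V &, injective id} -> #|solo h (id @: V)| <= #|solo (h \o id) V|.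
Proof.
move=> idI; apply: leq_trans (leq_imset_card id _).
apply/subset_leq_card/subsetP => x /soloP[/imsetP[v vV ->] F].
apply/imset_f/soloP; split=> // u uV hu; apply: idI => //.
by apply: F => //; apply: imset_f.
Qed.

(** Pigeonhole: [2 ^ H] blocks of at most [H] devices hold at most [2 ^ H * H] in total. For [H = 0]
    any nonempty block qualifies. *)
Lemma dense_promises lam H a : (H = 0 \/ 2 ^ H * H < a) -> 0 < a ->
  promises (Dense lam H) a.
Proof.
move=> Ha a_gt0 I V id idI aV /=.
have V_gt0 := leq_trans a_gt0 aV.
have : [exists v in V, H < #|block V id lam (id v %/ 2 ^ lam)|]; last by move/exists_inP.
apply: contraTT aV => /exists_inPn none; rewrite -ltnNge.
case: Ha => [H0|]; first case/card_gt0P: V_gt0 => v vV.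
  have := none v vV; rewrite -leqNgt => /leq_trans/(_ (eq_leq H0)).
  rewrite leqn0 cards_eq0 => /eqP E.
  have : v \in block V id lam (id v %/ 2 ^ lam) by rewrite inE vV eqxx.
  by rewrite E in_set0.
apply: leq_ltn_trans.
have gH v : id v %/ 2 ^ lam < 2 ^ H.
  by rewrite ltn_divLR ?expn_gt0 // mulnC -expnD; apply: ltn_ord.
rewrite -sum1_card (partition_big (fun v => Ordinal (gH v)) xpredT) //=.
apply: (@leq_trans (\sum_(g < 2 ^ H) H)); last by rewrite sum_nat_const card_ord.
apply: leq_sum => g _.
rewrite sum1_card.
have [v /andP[vV /eqP gv]|none'] := pickP [pred v | (v \in V) && (Ordinal (gH v) == g)].
  have := none v vV; rewrite -leqNgt; apply: leq_trans.
  apply/subset_leq_card/subsetP => u; rewrite !inE => /andP[-> /eqP gu].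
  by rewrite -[id u %/ _]/(val (Ordinal (gH u))) gu -gv eqxx.
by rewrite eq_card0.
Qed.

(** If [al <= l + 200], there is a single block. Otherwise [H = al - l - 200] is below [2 ^ l], so
    [2 ^ H * H < 2 ^ (H + l) <= 2 ^ (al - e)]. *)
Lemma dense_plan al e L l : al <= L -> L < 2 ^ l -> e <= 200 ->
  exists P : plan (2 ^ al),
    [/\ promises P (2 ^ (al - e)), plan_time P <= 2 ^ al * (2 * L).+1 &
        plan_energy P <= 2 * l + 404].
Proof.
move=> alL Ll e200; pose lam := minn al (l + 200); pose H := al - lam.
have E : al = lam + H by rewrite /H /lam; lia.
have Ha : H = 0 \/ 2 ^ H * H < 2 ^ (al - e).
  case: (posnP H) => [|H_gt0]; [by left | right].
  apply: (@leq_trans (2 ^ (H + l))); last by rewrite leq_exp2l // /H /lam in H_gt0 *; lia.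
  by rewrite expnD ltn_pmul2l ?expn_gt0 // (leq_ltn_trans _ Ll) //; lia.
have e_gt0 : 0 < 2 ^ (al - e) by rewrite expn_gt0.
have lam_le : lam <= l + 200 by rewrite /lam geq_minr.
clearbody lam H; subst al; exists (Dense lam H); split.
- exact: dense_promises.
- by rewrite /= /dense_time; move: (2 ^ (lam + H)) => q; nia.
- by rewrite /=; lia.
Qed.

(** [e] is the logarithm of the inverse density. Each round multiplies it by at most 3/4 until it is
    at most 200, at the price of 16 units of energy, for eight maps, and of doubling the time
    bound. *)
Lemma sparse_plan L l : L < 2 ^ l -> forall f al e, al <= L ->
  e * 3 ^ f <= 200 * 4 ^ f ->
  exists P : plan (2 ^ al),
    [/\ promises P (2 ^ (al - e)), plan_time P <= 2 ^ al * ((2 * L).+1 * 2 ^ f) &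
        plan_energy P <= 16 * f + (2 * l + 404)].
Proof.
move=> Ll; set K := (2 * L).+1; elim=> [|f IH] al e alL ef.
  by have [|P [? ? ?]] := dense_plan alL Ll (e := e); [lia | exists P; rewrite muln1].
(* For [e > al], truncated subtraction gives the threshold 1, as for [e = al]. *)
wlog : e ef / e <= al.
  move=> W; have [|lt] := leqP e al; first exact: W.
  have [||P] := W al; rewrite ?leqnn //.
    by apply: leq_trans ef; rewrite leq_mul2r ltnW ?orbT.
  by exists P; rewrite (_ : al - e = al - al) //; lia.
move=> eal; have [e200|e200] := leqP e 200.
  have [P [P1 P2 P3]] := dense_plan alL Ll e200; exists P; split=> //; last by lia.
  by apply: leq_trans P2 _; rewrite leq_mul2l leq_pmulr ?orbT // expn_gt0.
(* The maps go from [2 ^ al] to [2 ^ be] for sets of size at most [2 ^ (al - 2 * m)]; the 10 is half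
   the exponent of [16 * 256 ^ 2]. Up to truncation, [P1] has threshold [2 ^ (al - e - 4)], a
   sixteenth of the promised number, and [P2] has half of [2 ^ (al - 2 * m)]. *)
set m := e %/ 3; pose be := al - m + 10; pose e1 := e - m + 14; pose e2 := 2 * m + 1.
have scale x : 4 * x <= 3 * e -> x * 3 ^ f <= 200 * 4 ^ f.
  by move: ef; rewrite !expnS; move: (3 ^ f) (4 ^ f) => a b; nia.
(* As [e > 200], both [e1] and [e2] are at most [3 * e / 4]. *)
have [||P1 [P1p P1t P1e]] := IH be e1; [lia | by apply: scale; lia |].
have [||P2 [P2p P2t P2e]] := IH al e2; [by [] | by apply: scale; lia |].
have [|||h hP] := @unique_neighbours (2 ^ al) (2 ^ be) 2 (2 ^ (al - 2 * m)).
- by rewrite expn_gt0.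
- by [].
- by rewrite -[16]/(2 ^ 4) -[256]/(2 ^ 8) expn1 -!expnM -!expnD leq_exp2l // /be; lia.
exists (plan_rows h (enum 'I_8) P1 P2); split.
- move=> I V id idI aV; pose b := (2 ^ (be - e1)).-1.
  have b1 : b.+1 = 2 ^ (be - e1) by rewrite prednK // expn_gt0.
  have cI : #|id @: V| = #|V| by apply: card_in_imset.
  have V_gt0 : 0 < #|V| by apply: leq_trans aV; rewrite expn_gt0.
  (* Unless one device is enough for [P1], eight failed calls remove at most [8 * b] devices, fewer
     than half of [#|V|] and of [2 ^ (al - 2 * m)]. *)
  have b0 : b = 0 \/ 16 * b.+1 <= #|V| /\ 16 * b.+1 <= 2 ^ (al - 2 * m).
    have [le|lt] := leqP be e1; first by left; rewrite /b (eqP le).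
    have E : 2 ^ (al - e) = 16 * b.+1.
      by rewrite b1 -[16]/(2 ^ 4) -expnD; congr (2 ^ _); rewrite /be /e1 in lt *; lia.
    by right; rewrite -E leq_exp2l //; split=> //; lia.
  apply: (elects_rows idI (b := b)); first by rewrite b1.
  rewrite size_enum_ord.
  have [Vt|tV] := leqP #|V| (2 ^ (al - 2 * m)).
    left; have [|j] := hP (id @: V); first by rewrite cI V_gt0.
    rewrite cI => le; exists j; first by rewrite mem_enum.
    have := solo_neighbours (h j) idI.
    move: le b0 V_gt0; move: #|V| #|solo _ V| #|solo _ (id @: V)| => x y z; lia.
  right=> U UV le; apply: P2p; first by move=> u v /(subsetP UV) uV /(subsetP UV); apply: idI.
  have E : 2 ^ (al - 2 * m) = 2 * 2 ^ (al - e2) by rewrite -expnS; congr (2 ^ _); lia.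
  by move: le b0 tV; rewrite E; move: (2 ^ _) #|V| #|U| => x y z; lia.
- rewrite plan_rows_time size_enum_ord expnS.
  (* The new space is at least 32 times smaller, so the eight calls on it fit together within the
     time bound of [P2]. *)
  have E : 2 ^ be * 2 ^ 5 <= 2 ^ al by rewrite -expnD leq_exp2l // /be; lia.
  have : 0 < K * 2 ^ f by rewrite muln_gt0 expn_gt0.
  have : 0 < 2 ^ be by rewrite expn_gt0.
  have -> : K * (2 * 2 ^ f) = 2 * (K * 2 ^ f) by rewrite mulnCA.
  move: (plan_time P1) (plan_time P2) E P1t P2t => T1 T2.
  by move: (2 ^ be) (2 ^ al) (K * 2 ^ f) => x y z; nia.
- have := @plan_rows_energy _ _ _ h (enum 'I_8) P1 P2 _ P1e P2e.
  by rewrite size_enum_ord; lia.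
Qed.

(** The first [4 * d] maps bring identifiers down to [be] bits. There the threshold is [2 ^ 0], so
    the first map with a device alone elects a leader and [Stop] can follow. *)
Theorem election_plan N n d be l : 0 < d -> be < 2 ^ l ->
  16 * 256 ^ d * N * n ^ d.-1 <= (2 ^ be) ^ d ->
  exists P : plan N,
    [/\ forall V : {set 'I_N}, admissible n V -> elects P V id,
        plan_time P <= 4 * d * (2 ^ be * (3 * (2 * be).+1 * 8 ^ l)) &
        plan_energy P <= 8 * d + 50 * l + 404].
Proof.
move=> d_gt0 bel Hd.
(* [3 * l] rounds suffice because [(4 / 3) ^ 3 > 2] and [be < 2 ^ l]. *)
have [|P1 [P1p P1t P1e]] := sparse_plan bel (f := 3 * l) (leqnn be) (e := be).
  apply: (@leq_trans (2 ^ l * 3 ^ (3 * l))); first by rewrite leq_mul2r ltnW ?orbT.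
  rewrite !expnM -expnMn; apply: (@leq_trans ((4 ^ 3) ^ l)); last by rewrite leq_pmull.
  by case: (l) => // j; rewrite leq_exp2r.
have [|//|//|h hP] := @unique_neighbours N (2 ^ be) d n; first by rewrite expn_gt0.
exists (plan_rows h (enum 'I_(4 * d)) P1 Stop); split.
- move=> V /andP[V_gt0 Vn]; rewrite subnn in P1p.
  have idI : {in V &, injective (@id 'I_N)} by [].
  apply: (elects_rows idI (b := 0)) => //; left; rewrite muln0.
  have [|j le] := hP V; first by rewrite V_gt0.
  exists j; first by rewrite mem_enum.
  have {}le : 0 < #|solo (h j) V| by lia.
  exact: le.
- rewrite plan_rows_time size_enum_ord /= addn0 leq_mul2l; apply/orP; right.
  rewrite expnM -[2 ^ 3]/8 in P1t.
  have : 0 < 2 ^ be by rewrite expn_gt0.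
  have : 0 < 8 ^ l by rewrite expn_gt0.
  move: (plan_time P1) P1t => T1; move: (2 ^ be) (8 ^ l) => y z; nia.
- have := @plan_rows_energy _ _ _ h (enum 'I_(4 * d)) P1 Stop _ P1e (leq0n _).
  by rewrite size_enum_ord; lia.
Qed.

Lemma election_plan_bounds N n d K : 0 < d -> 0 < K -> 0 < n <= N -> N <= 2 ^ 2 ^ K ->
  exists (P : plan N) (be : nat),
    [/\ 0 < be /\ (2 ^ be.-1) ^ d <= 4096 ^ d * N * n ^ d,
        forall V : {set 'I_N}, admissible n V -> elects P V id,
        plan_time P <= 288 * d * (2 ^ be * be ^ 4) &
        plan_energy P <= 8 * d + 704 * K].
Proof.
move=> d_gt0 K_gt0 /andP[n_gt0 nN] NK.
set M := 16 * 256 ^ d * N * n ^ d.-1.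
have M_le : M <= 4096 ^ d * N * n ^ d.
  apply: leq_mul; last by rewrite leq_pexp2l // leq_pred.
  have le b : 0 < b -> b <= b ^ d.
    by move=> b_gt0; rewrite -{1}(expn1 b) leq_pexp2l.
  by rewrite leq_mul2r (_ : 4096 = 16 * 256) // expnMn leq_mul2r le ?orbT.
have M_gt1 : 1 < M.
  rewrite /M -!mulnA; apply: (@leq_trans (16 * 1)) => //.
  by rewrite leq_mul2l !muln_gt0 !expn_gt0 n_gt0 (leq_trans n_gt0 nN).
have ex : exists be, M <= (2 ^ be) ^ d.
  exists M; apply: leq_trans (ltnW (ltn_expl M (isT : 1 < 2))) _.
  by rewrite -{1}[2 ^ M]expn1 leq_pexp2l // expn_gt0.
(* By minimality [be.-1] violates the condition, which bounds [2 ^ be] from above. *)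
case: (ex_minnP ex) => be beM be_min.
have be_gt0 : 0 < be.
  by case: (be) beM => //; rewrite expn0 exp1n leqNgt M_gt1.
have be_lt : (2 ^ be.-1) ^ d < M.
  by rewrite ltnNge; apply/negP => /be_min; rewrite leqNgt ltn_predL be_gt0.
(* Both [n] and [N] are at most [2 ^ 2 ^ K]. Hence [l] is [K + O(1)], which keeps the energy linear
   in [K] for fixed [d]. *)
have be_le : be <= 2 ^ (K + 4).
  have : 2 ^ (be.-1 * d) < 2 ^ ((12 + 2 * 2 ^ K) * d).
    rewrite expnM; apply: leq_trans be_lt (leq_trans M_le _).
    have -> : (12 + 2 * 2 ^ K) * d = 12 * d + 2 ^ K * d + 2 ^ K * d by lia.
    rewrite 2!expnD (expnM 2 12 d); apply: leq_mul.
      apply: leq_mul; first by rewrite (_ : 4096 = 2 ^ 12).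
      by apply: leq_trans NK _; rewrite leq_exp2l // leq_pmulr.
    by rewrite expnM leq_exp2r // (leq_trans nN).
  rewrite ltn_exp2l // ltn_pmul2r // expnD -[2 ^ 4]/16.
  by have := leq_pexp2l (isT : 0 < 2) K_gt0; move: (2 ^ K) => a; lia.
pose l := (trunc_log 2 be).+1.
have [l1 l2] : 2 ^ l <= 2 * be /\ be < 2 ^ l.
  have /andP[le lt] := trunc_log_bounds (isT : 1 < 2) be_gt0.
  by split=> //; rewrite expnS leq_mul2l.
have lK : l <= K + 5.
  suff : 2 ^ l <= 2 ^ (K + 5) by rewrite leq_exp2l.
  by apply: leq_trans l1 _; rewrite addnS expnS leq_mul2l.
have [P [P1 P2 P3]] := election_plan d_gt0 l2 beM.
exists P, be; split=> //; last by lia.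
  by split=> //; apply: leq_trans (ltnW be_lt) M_le.
apply: leq_trans P2 _.
have l8 : 8 ^ l <= 8 * be ^ 3.
  by rewrite -[8]/(2 ^ 3) -expnM mulnC expnM -expnMn leq_exp2r.
have E : be ^ 4 = be * be ^ 3 by rewrite expnS.
rewrite E; have : 0 < be ^ 3 by rewrite expn_gt0 be_gt0.
move: l8; move: (8 ^ l) (be ^ 3) (2 ^ be) => a b p H b_gt0.
apply: (@leq_trans (4 * d * (p * (3 * (3 * be) * (8 * b))))); last by nia.
by rewrite !leq_mul //; lia.
Qed.

From mathcomp Require Import all_order all_algebra ring lra.
From mathcomp Require Import all_classical all_reals all_analysis.
Import Order.TTheory GRing.Theory Num.Theory.
Local Open Scope ring_scope.

(** * Real estimates for the time bound *)

Section RealBounds.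
Variable R : realType.

Lemma powR_expR (x a : R) : 0 < x -> x `^ a = expR (a * ln x).
Proof. by move=> x0; rewrite /powR gt_eqF. Qed.

Lemma log2_log2_le (N K : nat) (k : R) : (1 <= N)%N -> k <= K%:R ->
  log2 (log2 N%:R) <= k -> (N <= 2 ^ 2 ^ K)%N.
Proof.
move=> N1 kK; have [N2|] := ltnP 1 N; last by move=> N1'; rewrite (leq_trans N1') ?expn_gt0.
have ln2 : 0 < ln 2 :> R by rewrite ln_gt0 // ltr1n.
have lnN : 0 < ln N%:R :> R by rewrite ln_gt0 // ltr1n.
have L0 : 0 < log2 N%:R :> R by rewrite /log2 divr_gt0.
rewrite {1}/log2 ler_pdivrMr // => H.
have {}H : log2 (N%:R : R) <= (2 ^ K)%:R.
  rewrite -(ler_ln (x := log2 N%:R)) ?posrE ?ltr0n ?expn_gt0 //.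
  rewrite natrX lnXn // -[ln 2 *+ K]mulr_natl (le_trans H) // ler_wpM2r //.
  exact: ltW.
move: H; rewrite /log2 ler_pdivrMr // => H.
rewrite -(ler_nat R) -ler_ln ?posrE ?ltr0n ?expn_gt0 //.
by rewrite natrX lnXn // -[ln 2 *+ _]mulr_natl.
Qed.

(** Logarithms are divided by [d]; the constant doubles from 4096 to 8192 to pass from [be.-1] to
    [be]. *)
Lemma expn_le_ln (N n d be : nat) : (0 < N)%N -> (0 < n)%N -> (0 < d)%N -> (0 < be)%N ->
  ((2 ^ be.-1) ^ d <= 4096 ^ d * N * n ^ d)%N ->
  be%:R * ln 2 <= ln 8192 + ln n%:R + ln N%:R / d%:R :> R.
Proof.
move=> N0 n0 d0 be0 le.
have : ln ((2 ^ be.-1) ^ d)%:R <= ln (4096 ^ d * N * n ^ d)%:R :> R.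
  by rewrite ler_ln ?posrE ?ltr0n ?muln_gt0 ?expn_gt0 ?n0 ?N0 // ler_nat.
rewrite !natrM !natrX !lnM ?posrE ?mulr_gt0 ?exprn_gt0 ?ltr0n // !lnXn ?exprn_gt0 ?ltr0n //.
rewrite -[X in X <= _]mulr_natl -[ln 2 *+ _]mulr_natl.
rewrite -[ln 4096 *+ _]mulr_natl -[ln n%:R *+ _]mulr_natl => H.
have d0' : 0 < d%:R :> R by rewrite ltr0n.
have -> : (8192 : R) = 2 * 4096 by rewrite -natrM.
rewrite lnM ?posrE ?ltr0n // -(ler_pM2l d0') !mulrDr [_ * (_ / _)]mulrC divfK ?gt_eqF //.
have beE : be%:R = be.-1%:R + 1 :> R by rewrite natr1 prednK.
by rewrite beE; lra.
Qed.

(** Absorbs the factor [be ^ 4] of the time into a small exponential: it is the fourth power of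
    [q * x <= expR (q * x)]. *)
Lemma pow4_le_expR (q x : R) : 0 < q -> 0 <= x -> x ^+ 4 <= q^-1 ^+ 4 * expR (4 * q * x).
Proof.
move=> q0 x0; have -> : 4 * q * x = 4%:R * (q * x) by rewrite mulrA.
rewrite expRM_natl -exprMn lerXn2r ?nnegrE ?mulr_ge0 ?invr_ge0 ?expR_ge0 //; first exact: ltW.
rewrite mulrC ler_pdivlMr // mulrC; apply: le_trans (expR_ge1Dx _).
by rewrite lerDr.
Qed.

(** Turns a product of powers of [n] and [N] into a sum. If [dl * x] dominates, the slack of the
    first exponential absorbs [y]; otherwise [x] is at most a constant times [y / c], and a large
    [c] lets the second absorb both. *)
Lemma product_le_sum (dl c x y : R) : 0 < dl -> (1 + dl) * (1 + 2 * dl) / dl <= c ->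
  0 <= x -> 0 <= y ->
  expR ((1 + dl) * (x + y / c)) <= expR ((1 + 2 * dl) * x) + expR y.
Proof.
move=> dl0 cP x0 y0.
have c0 : 0 < c by apply: lt_le_trans cP; rewrite divr_gt0 // mulr_gt0 //; lra.
have [le|gt] := lerP ((1 + dl) * (y / c)) (dl * x).
  rewrite -[X in X <= _]addr0 lerD ?expR_ge0 // ler_expR; lra.
rewrite -[X in X <= _]add0r lerD ?expR_ge0 // ler_expR.
set z := y / c in gt *; have yE : y = z * c by rewrite /z divfK // gt_eqF.
have z0 : 0 <= z by rewrite /z divr_ge0 // ltW.
have h1 : dl * ((1 + dl) * (x + z)) <= z * ((1 + dl) * (1 + 2 * dl)) by nra.
have h2 : z * ((1 + dl) * (1 + 2 * dl)) <= z * (c * dl).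
  by rewrite ler_wpM2l // -ler_pdivrMr.
by rewrite yE -(ler_pM2l dl0); lra.
Qed.
End RealBounds.

(** * Choice of the constants and assembly *)

Theorem theorem2p1 (R : realType) (eps : R) (heps : 0 < eps) :
  exists (alg : forall N : nat, nat -> R -> algorithm N) (C : R),
    0 < C /\
    forall (N n : nat) (k : R),
      (1 <= N)%N -> (1 <= n)%N -> 1 <= k -> log2 (log2 N%:R) <= k ->
      solves_leader_election n (alg N n k) /\
      exists T E : nat,
        [/\ time_complexity_le n (alg N n k) T,
            T%:R <= C * (k * N%:R `^ (1 / k) + k * n%:R `^ (1 + eps)),
            energy_complexity_le n (alg N n k) E
          & E%:R <= C * k].
Proof.
pose dl := eps / 2; have dl0 : 0 < dl by rewrite divr_gt0.
(* With [d = c * K] maps up to a constant, [N] enters the new identifier space with exponent at most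
   [1 / (c * k)], as [product_le_sum] requires. *)
have [c cn0 cP] : exists2 c, (0 < c)%N & (1 + dl) * (1 + 2 * dl) / dl <= c%:R.
  exists (Num.truncn ((1 + dl) * (1 + 2 * dl) / dl)).+1 => //.
  have /truncn_itv/andP[_ /ltW//] : 0 <= (1 + dl) * (1 + 2 * dl) / dl.
  by rewrite divr_ge0 ?mulr_ge0 //; lra.
have c0 : 0 < c%:R :> R by rewrite ltr0n.
have ln2 : 0 < ln 2 :> R by rewrite ln_gt0 // ltr1n.
(* Makes [expR (4 * q * be)] equal to [2 ^ (dl * be)]. *)
pose q := dl * ln 2 / 4; have q0 : 0 < q by rewrite divr_gt0 ?mulr_gt0.
pose C1 : R := q^-1 ^+ 4 * expR ((1 + dl) * ln 8192).
have C10 : 0 < C1 by rewrite mulr_gt0 ?expR_gt0 ?exprn_gt0 ?invr_gt0.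
(* The first summand pays for the time, the second for the energy [8 * c * K + 704 * K]; the factor
   2 in both comes from [K <= 2 * k]. *)
pose C : R := 576 * c%:R * C1 + (16 * c%:R + 1408).
have C0 : 0 < C by rewrite /C; have := mulr_gt0 c0 C10; clearbody C1; lra.
(* The algorithm must exist for all parameters, so the hypotheses come after it; where one of them
   fails, any algorithm will do. *)
suff key : forall (N n : nat) (k : R), exists alg : algorithm N,
    (1 <= N)%N -> (1 <= n)%N -> 1 <= k -> log2 (log2 N%:R) <= k ->
    solves_leader_election n alg /\
    exists T E : nat,
      [/\ time_complexity_le n alg T,
          T%:R <= C * (k * N%:R `^ (1 / k) + k * n%:R `^ (1 + eps)),
          energy_complexity_le n alg E & E%:R <= C * k].
  exists (fun N n k => projT1 (cid (key N n k))), C; split=> // N n k.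
  exact: projT2 (cid (key N n k)).
move=> N n k.
have [N1|] := boolP (1 <= N)%N; last by exists (fun _ _ => Idle).
have [n1|] := boolP (1 <= n)%N; last by exists (fun _ _ => Idle).
have [k1|] := boolP (1 <= k); last by exists (fun _ _ => Idle).
have [hk|] := boolP (log2 (log2 N%:R) <= k); last by exists (fun _ _ => Idle).
have k0 : 0 < k by apply: lt_le_trans k1.
have [K [K0 kK K2]] : exists K, [/\ (0 < K)%N, k <= K%:R & K%:R <= 2 * k].
  have /andP[le lt] := truncn_itv (ltW k0); exists (Num.truncn k).+1.
  by split; [| exact: ltW | rewrite -natr1; clear -k1 le; lra].
have cK0 : (0 < c * K)%N by rewrite muln_gt0 cn0.
(* [n] may exceed [N], while [election_plan_bounds] requires [n <= N]; no [V] has more than [N]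
   devices. *)
pose n' := minn n N.
have [//|//|||P [be [[be0 beP] elP PT PE]]] := @election_plan_bounds N n' (c * K) K.
  by rewrite leq_min n1 N1 geq_minr.
  exact: log2_log2_le hk.
have el V : admissible n V -> elects P V id.
  move=> /andP[V1 Vn]; apply: elP; rewrite /admissible V1 /n' leq_min Vn.
  by rewrite -[leqRHS]card_ord max_card.
have [solves time energy] := plan_solves el.
exists (algorithm_of (plan_prog P)) => _ _ _ _; split=> //.
have h : c%:R * K%:R <= c%:R * (2 * k) by rewrite ler_pM2l.
exists (plan_time P), (plan_energy P); split=> //; last first.
  have : (plan_energy P)%:R <= (8 * (c * K) + 704 * K)%:R :> R by rewrite ler_nat.
  rewrite natrD !natrM => /le_trans; apply.
  have pos : 0 <= c%:R * C1 * k by apply: mulr_ge0; apply: ltW => //; apply: mulr_gt0.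
  by rewrite /C; clearbody C1; clear -pos h K2; lra.
have n'0 : (0 < n')%N by rewrite leq_min n1 N1.
set y := ln N%:R / k.
have y0 : 0 <= y by rewrite divr_ge0 ?ln_ge0 ?ler1n // ltW.
have x0 : 0 <= ln n%:R :> R by rewrite ln_ge0 ?ler1n.
have be_le : be%:R * ln 2 <= ln 8192 + (ln n%:R + y / c%:R) :> R.
  have := @expn_le_ln R N n' (c * K) be N1 n'0 cK0 be0 beP.
  move=> /le_trans; apply; rewrite -addrA lerD2l lerD //.
    by rewrite ler_ln ?posrE ?ltr0n // ler_nat geq_minl.
  rewrite /y -mulrA -invfM ler_wpM2l ?ln_ge0 ?ler1n // lef_pV2 ?posrE ?mulr_gt0 ?ltr0n //.
  by rewrite natrM mulrC ler_pM2l.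
have sum_le : (2 ^ be * be ^ 4)%:R <= C1 * (n%:R `^ (1 + eps) + N%:R `^ (1 / k)) :> R.
  rewrite natrM !natrX.
  have -> : (2 : R) ^+ be = expR (be%:R * ln 2) by rewrite expRM_natl lnK ?posrE.
  apply: (@le_trans _ _ (expR (be%:R * ln 2) * (q^-1 ^+ 4 * expR (4 * q * be%:R)))).
    by rewrite ler_wpM2l ?expR_ge0 // pow4_le_expR.
  rewrite mulrCA -expRD.
  have -> : be%:R * ln 2 + 4 * q * be%:R = (1 + dl) * (be%:R * ln 2).
    by rewrite /q; field.
  rewrite /C1 -[leRHS]mulrA ler_wpM2l ?exprn_ge0 ?invr_ge0 // ?(ltW q0) //.
  apply: (@le_trans _ _ (expR ((1 + dl) * ln 8192) * expR ((1 + dl) * (ln n%:R + y / c%:R)))).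
    by rewrite -expRD -mulrDr ler_expR; apply: (ler_wpM2l _ be_le); rewrite addr_ge0 // ltW.
  rewrite ler_wpM2l ?expR_ge0 //.
  apply: le_trans (product_le_sum dl0 cP x0 y0) _.
  rewrite !powR_expR ?ltr0n // /y mul1r [ln N%:R / k]mulrC.
  by rewrite (_ : 1 + 2 * dl = 1 + eps) // /dl; field.
have : (plan_time P)%:R <= (288 * (c * K) * (2 ^ be * be ^ 4))%:R :> R by rewrite ler_nat.
move=> /le_trans; apply; rewrite 2!natrM (natrM _ c).
rewrite -mulrDr [X in k * X]addrC.
set S := n%:R `^ _ + _ in sum_le *.
have S0 : 0 <= S by rewrite addr_ge0 // powR_ge0.
apply: (@le_trans _ _ (288 * (c%:R * (2 * k)) * (C1 * S))).
  by rewrite -!(mulrA 288) ler_wpM2l ?ler0n // ler_pM ?mulr_ge0 ?ler0n.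
have pos : 0 <= (16 * c%:R + 1408) * (k * S).
  apply: mulr_ge0; last exact: mulr_ge0 (ltW k0) S0.
  by apply: addr_ge0; rewrite -?natrM ler0n.
by rewrite /C; clearbody C1 S; clear -pos; lra.
Qed.
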